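(* Let $N\in\{1,2,\ldots\}$, let $\mathbf{l}=(l_1,\ldots,l_N)\in\mathcal{L}^N$ be ordered with minimal partition $(\mathbf{l}^{(1)},\ldots,\mathbf{l}^{(N_{\rm blocks})})$, and let $L\in\mathcal{L}$. Let $M^{\mathbf{l},L}$ be the matrix obtained by stacking vertically $M_1,\ldots,M_{N_{\rm dim}}$, where for $d=1,\ldots,N_{\rm dim}$ and $(\mathbf{m},k),(\mathbf{m}',k')\in\overline{\mathcal{M}}_{\mathbf{l}}\times\mathcal{M}_L$, $$M_d[(\mathbf{m},k),(\mathbf{m}',k')]=\begin{cases}\sum_{j=1}^N\varrho^{l_j,d}_{m_j,m_j}-\varrho^{L,d}_{k,k}, & \text{if } \mathbf{m}=\mathbf{m}',\ k=k',\\ -\varrho^{L,d}_{k,k'}, & \text{if } \mathbf{m}=\mathbf{m}',\ k\neq k',\\ \lambda_{\mathbf{m}'^{(j)},q}\;\varrho^{\mathbf{l}^{(j)}_1,d}_{q,p}, & \text{if } \mathbf{m}'=\mathbf{m}_{(j,p,q)}\in\mathcal{N}_{\mathbf{m}},\ k=k',\\ 0,&\text{otherwise.}\end{cases}$$ Let $\mathbf{c}_i=\{c_{\mathbf{m},k,i}\}_{\mathbf{m}\in\overline{\mathcal{M}}_{\mathbf{l}},k\in\mathcal{M}_L}$, $i=1,\ldots,\dim(\ker(M^{\mathbf{l},L}))$, be a basis of $\ker(M^{\mathbf{l},L})$. Then a basis of the space $\bar V^{\mathbf{l},L}$ of group-equivariant and permutation-invariant functions is given by $$b_i=\Big[\sum_{\mathbf{m}\in\overline{\mathcal{M}}_{\mathbf{l}}}c_{\mathbf{m},k,i}\,\bar\phi^{\mathbf{l}}_{\mathbf{m}}\Big]_{k\in\mathcal{M}_L},\qquad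 i=1,\ldots,\dim(\ker(M^{\mathbf{l},L})).$$ Thus $\dim(\bar V^{\mathbf{l},L})=\dim(\ker(M^{\mathbf{l},L}))$.
   Context: Setting. $G$ is a connected linear Lie group with neutral element $e$ and Lie algebra $\mathfrak{g}$; $X_1,\ldots,X_{N_{\rm dim}}$ is a set of generators of $\mathfrak{g}$. $\mathbb{K}\in\{\mathbb{R},\mathbb{C}\}$, and $\mathbb{F}$ is a $\mathbb{K}$-vector space in which values of the functions below can be multiplied (a commutative $\mathbb{K}$-algebra, e.g. $\mathbb{F}=\mathbb{K}$). $G$ acts on a domain $\Omega$ and diagonally on $\Omega^N$. $\mathcal{L}$ is a (countable) totally ordered index set; for each $l\in\mathcal{L}$, $\mathcal{M}_l$ is a finite totally ordered set and $V^l=\mathrm{Span}_{\mathbb K}\{\phi^l_m: m\in\mathcal{M}_l\}$ with $\phi^l_m:\Omega\to\mathbb{F}$ orthonormal: $\langle\phi^l_m,\phi^{l'}_{m'}\rangle=\delta_{ll'}\delta_{mm'}$. Each $V^l$ is stable under $G$, with (continuous) matrix representation $\rho^l$: $\phi^l_m(g\cdot r)=\sum_{m'\in\mathcal{M}_l}\rho^l_{m,m'}(g)\phi^l_{m'}(r)$. Set $\varrho^{l,d}:=d\rho^l(X_d)=\frac{d}{dt}|_{t=0}\rho^l(\exp(tX_d))$. For $\mathbf{l}\in\mathcal{L}^N$, $\mathcal{M}_{\mathbf{l}}=\prod_i\mathcal{M}_{l_i}$; the functions $\phi^{\mathbf{l}}_{\mathbf{m}}(r_1,\ldots,r_N)=\prod_i\phi^{l_i}_{m_i}(r_i)$,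 over all $\mathbf l\in\mathcal L^N$, $\mathbf m\in\mathcal M_{\mathbf l}$, are orthonormal for the tensor-product scalar product. Permutation-invariant functions. $\bar\phi^l_m(r_1,\ldots,r_N)=\sum_{i=1}^N\phi^l_m(r_i)$, $\bar\phi^{\mathbf{l}}_{\mathbf{m}}=\prod_{i=1}^N\bar\phi^{l_i}_{m_i}$ (functions on $\Omega^N$), and $\bar V^{\mathbf{l}}=\mathrm{Span}\{\bar\phi^{\mathbf{l}}_{\mathbf{m}}:\mathbf{m}\in\mathcal{M}_{\mathbf{l}}\}$. With $\mathcal{S}_{\mathbf{l}}=\{\pi\in S_N:\pi\mathbf{l}=\mathbf{l}\}$, $\overline{\mathcal{M}}_{\mathbf{l}}$ is the set of classes of $\mathcal{M}_{\mathbf{l}}$ under $\mathbf{m}\sim\mathbf{m}'\Leftrightarrow\exists\pi\in\mathcal{S}_{\mathbf{l}},\ \mathbf{m}'=\pi\mathbf{m}$; $\bar\phi^{\mathbf{l}}_{\mathbf{m}}$ depends only on the class. $\bar V^{\mathbf{l},L}$ is the space of functions $F\in[\bar V^{\mathbf{l}}]^{|\mathcal{M}_L|}$ with $F(g\cdot R)=\rho^L(g)F(R)$ for all $g\in G$, $R\in\Omega^N$ (they are automatically permutation-invariant). Minimal partition. $\mathbf{l}$ ordered is written as a concatenation of blocks $\mathbf{l}^{(1)},\ldots,\mathbf{l}^{(N_{\rm blocks})}$, each consisting of a single repeated value, different blocks having different values; $\mathbf{l}^{(j)}_1$ is the value of block $j$. Accordingly $\mathbf{m}=(\mathbf{m}^{(1)},\ldots,\mathbf{m}^{(N_{\rm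 blocks})})$, and each class is represented by the $\mathbf{m}$ with every $\mathbf{m}^{(j)}$ ordered. Count vectors. For a class $\mathbf{m}$, $\lambda_{\mathbf{m}^{(j)}}=(\lambda_{\mathbf{m}^{(j)},p})_{p\in\mathcal{M}_{\mathbf{l}^{(j)}_1}}$, where $\lambda_{\mathbf{m}^{(j)},p}$ is the number of occurrences of $p$ in $\mathbf{m}^{(j)}$. The class is uniquely determined by $(\lambda_{\mathbf{m}^{(1)}},\ldots,\lambda_{\mathbf{m}^{(N_{\rm blocks})}})$. Interacting classes. For $j\in\{1,\ldots,N_{\rm blocks}\}$, $p\neq q$ in $\mathcal{M}_{\mathbf{l}^{(j)}_1}$ with $\lambda_{\mathbf{m}^{(j)},p}>0$, $\mathbf{m}_{(j,p,q)}$ is the class whose count vectors are those of $\mathbf{m}$ except that the $j$-th is $\lambda_{\mathbf{m}^{(j)}}-\mathbf{e}_p+\mathbf{e}_q$ (one $p$ in block $j$ replaced by $q$). $\mathcal{N}_{\mathbf{m}}$ is the set of all such $\mathbf{m}_{(j,p,q)}$. Kernels are taken over $\mathbb{K}$. *)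

(* Defs.v *)
From HB Require Import structures.
From mathcomp Require Import all_boot all_order perm all_algebra complex.
From mathcomp Require Import all_classical all_reals all_analysis.

Set Implicit Arguments.
Unset Strict Implicit.
Unset Printing Implicit Defensive.

Import Order.TTheory GRing.Theory Num.Theory.
Import numFieldNormedType.Exports.

Local Open Scope classical_set_scope.
Local Open Scope ring_scope.

Variant scalar_kind := RealScalars | ComplexScalars.

Definition base_field (R : realType) (k : scalar_kind) : numFieldType :=
  match k with RealScalars => R | ComplexScalars => R[i] end.

Definition of_real (R : realType) (k : scalar_kind) : R -> base_field R k :=
  match k with RealScalars => id | ComplexScalars => real_complex R end.
Arguments of_real {R} k _.

Definition conj_scalar (R : realType) (k : scalar_kind) :
    base_field R k -> base_field R k :=
  match k with RealScalars => id | ComplexScalars => @conjc R end.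
Arguments conj_scalar {R k} _.

(* The derivative at 0 of a K-valued function of a real variable: the library's
   ['D_v] does not apply when K = R[i], which is not a normed R-module there. *)
Definition real_derivative0 (R : realType) (k : scalar_kind)
    (f : R -> base_field R k) : base_field R k :=
  lim ((of_real k t)^-1 * (f t - f 0) @[t --> (0 : R)^']).

Section VectorSpaces.
Variables (R : realType) (k : scalar_kind).
Local Notation K := (base_field R k).
Variable E : lmodType K.

Definition is_subspace (V : set E) : Prop :=
  V 0 /\ forall (a : K) (u v : E), V u -> V v -> V (a *: u + v).

Definition is_basis (V : set E) (n : nat) (b : 'I_n -> E) : Prop :=
  [/\ forall i, V (b i),
      forall a : 'I_n -> K, \sum_(i < n) a i *: b i = 0 -> forall i, a i = 0
    & forall v, V v -> exists a : 'I_n -> K, v = \sum_(i < n) a i *: b i].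

Definition has_dim (V : set E) (n : nat) : Prop :=
  exists b : 'I_n -> E, is_basis V b.

Definition scalar_product (V : set E) (ip : E -> E -> K) : Prop :=
  is_subspace V /\
  [/\ forall (a : K) (u v w : E), V u -> V v -> V w ->
        ip (a *: u + v) w = a * ip u w + ip v w,
      forall u v, V u -> V v -> ip v u = conj_scalar (ip u v),
      forall u, V u -> 0 <= ip u u
    & forall u, V u -> ip u u = 0 -> u = 0].

End VectorSpaces.

Section LinearLieGroups.
Variables (R : realType) (k : scalar_kind) (n : nat).
Local Notation F := (base_field R k).
Implicit Types (A B : 'M[F]_n) (G : set 'M[F]_n).

Definition expm A : 'M[F]_n :=
  lim (series (fun j : nat => (j`!%:R : F)^-1 *: A ^+ j) @ \oo).

Definition linear_Lie_group G : Prop :=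
  [/\ forall A, G A -> A \in unitmx,
      G 1%:M,
      forall A B, G A -> G B -> G (A *m B),
      forall A, G A -> G (invmx A)
    & closure G `&` [set A | A \in unitmx] `<=` G].

Definition Lie_algebra G : set 'M[F]_n :=
  [set A | forall t : R, G (expm (of_real k t *: A))].

Definition Lie_subalgebra (h : set 'M[F]_n) : Prop :=
  [/\ h 0,
      forall A B, h A -> h B -> h (A + B),
      forall (t : R) A, h A -> h (of_real k t *: A)
    & forall A B, h A -> h B -> h (A *m B - B *m A)].

Definition Lie_generators G (Ndim : nat) (X : 'I_Ndim -> 'M[F]_n) : Prop :=
  (forall d, Lie_algebra G (X d)) /\
  forall h, Lie_subalgebra h -> (forall d, h (X d)) -> Lie_algebra G `<=` h.

Definition group_action G (Omega : Type) (act : 'M[F]_n -> Omega -> Omega) :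
    Prop :=
  (forall r, act 1%:M r = r) /\
  forall A B, G A -> G B -> forall r, act (A *m B) r = act A (act B r).

Definition matrix_representation G (k' : scalar_kind) (J : finType)
    (rho : 'M[F]_n -> J -> J -> base_field R k') : Prop :=
  [/\ forall i j, rho 1%:M i j = (i == j)%:R,
      forall A B, G A -> G B -> forall i j,
        rho (A *m B) i j = \sum_p rho A i p * rho B p j
    & forall i j, {within G, continuous (fun A => rho A i j)}].

End LinearLieGroups.

Section Indices.
Context {dL dM : Order.disp_t} {calL : orderType dL}.
Variables (M : calL -> finOrderType dM) (N : nat).

Definition multi_index (l : 'I_N -> calL) := {dffun forall i : 'I_N, M (l i)}.

Variable l : 'I_N -> calL.
Implicit Types m : multi_index l.

(* Components of [m] live in the different types [M (l i)]; they are compared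
   in the disjoint union {x : calL & M x}. *)
Definition label m (i : 'I_N) : {x : calL & M x} := Tagged M (m i).

Definition same_class m m' : bool :=
  [exists s : {perm 'I_N},
    [forall i, l (s i) == l i] && [forall i, label m' i == label m (s i)]].

Lemma same_class_equiv : equiv_class_of same_class.
Proof.
split=> [m|m m'|m2 m1 m3].
- by apply/existsP; exists 1%g; apply/andP; split; apply/forallP=> i;
    rewrite perm1.
- have sym m1 m2 : same_class m1 m2 -> same_class m2 m1.
    case/existsP=> s /andP[/forallP sl /forallP sm].
    apply/existsP; exists (s^-1)%g; apply/andP; split; apply/forallP=> i.
      by rewrite -(eqP (sl _)) permKV.
    by rewrite (eqP (sm _)) permKV.
  by apply/idP/idP; exact: sym.
- case/existsP=> s /andP[/forallP sl /forallP sm].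
  case/existsP=> t /andP[/forallP tl /forallP tm].
  apply/existsP; exists (t * s)%g; apply/andP; split; apply/forallP=> i.
    by rewrite permM (eqP (sl _)) tl.
  by rewrite permM (eqP (tm _)) (eqP (sm _)).
Qed.

Canonical same_class_equiv_rel := EquivRelPack same_class_equiv.

Definition multi_class := {eq_quot same_class}%qT.

HB.instance Definition _ := Choice.on multi_class.
HB.instance Definition _ : EqQuotient _ same_class multi_class :=
  EqQuotient.on multi_class.
HB.instance Definition _ := Finite.copy multi_class
  (can_type (@EquivQuot.ereprK _ _ _ _ _ (defaultEncModRel same_class))).

(* When [l] is ordered, the positions carrying a given value are consecutive,
   so that the blocks of the minimal partition are the level sets of [l]. *)
Definition block_values : seq calL := undup (codom l).

Definition Nblocks : nat := size block_values.

Definition block_val (j : 'I_Nblocks) : calL := tnth (in_tuple block_values) j.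

Definition block (j : 'I_Nblocks) : seq 'I_N :=
  [seq i <- enum 'I_N | l i == block_val j].

Definition lambda m (j : 'I_Nblocks) (p : M (block_val j)) : nat :=
  count_mem (Tagged M p) [seq label m i | i <- block j].

Lemma lambda_same_class m m' (j : 'I_Nblocks) (p : M (block_val j)) :
  same_class m m' -> lambda m' p = lambda m p.
Proof.
case/existsP=> s /andP[/forallP sl /forallP sm].
rewrite /lambda /block !count_map !count_filter -!sum1_count.
rewrite [RHS](reindex_inj (@perm_inj _ s)) /=.
by apply: eq_bigl => i; rewrite /= (eqP (sl i)) (eqP (sm i)).
Qed.

Lemma flatten_blocks :
  (forall i j : 'I_N, (i <= j)%N -> (l i <= l j)%O) ->
  flatten [seq [seq l i | i <- block j] | j <- enum 'I_Nblocks] = codom l.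
Proof.
move=> l_ord; have sl : sorted <=%O (codom l).
  rewrite /codom /image_mem sorted_map.
  apply: (@sub_sorted _ (relpre val leq)); first by move=> i j; apply: l_ord.
  by rewrite -sorted_map val_enum_ord iota_sorted.
have sb : sorted <%O block_values.
  by rewrite lt_sorted_uniq_le undup_uniq (subseq_sorted le_trans (undup_subseq _)).
have -> : [seq [seq l i | i <- block j] | j <- enum 'I_Nblocks]
    = [seq [seq x <- codom l | x == v] | v <- block_values].
  transitivity [seq [seq x <- codom l | x == v] |
      v <- [seq block_val j | j <- enum 'I_Nblocks]]; last first.
    by rewrite (map_tnth_enum (in_tuple block_values)).
  rewrite -[RHS]map_comp; apply: eq_map.
  by move=> j; rewrite /= /block /codom /image_mem filter_map.
apply: (sorted_eq le_trans le_anti) => //.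
  have : all (mem (codom l)) block_values by apply/allP => v; rewrite mem_undup.
  elim: block_values sb => //= v s IHs pvs /andP[_ /(IHs (path_sorted pvs)) ss].
  rewrite (@sorted_pairwise _ <=%O le_trans) pairwise_cat.
  rewrite -!(sorted_pairwise le_trans) ss andbT.
  rewrite (sorted_filter le_trans) // andbT.
  apply/allrelP => x y; rewrite mem_filter => /andP[/eqP-> _].
  case/flattenP=> _ /mapP[w ws ->]; rewrite mem_filter => /andP[/eqP-> _].
  by apply: ltW; move: pvs; rewrite (path_sortedE lt_trans) => /andP[/allP/(_ _ ws)].
have := perm_count_undup (codom l); rewrite -/block_values; congr perm_eq.
congr flatten; apply: eq_map => v.
by rewrite -size_filter; apply/esym/all_pred1P; rewrite filter_all.
Qed.

Definition lambda_class (m : multi_class) (j : 'I_Nblocks)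
    (p : M (block_val j)) : nat := lambda (repr m) p.

Definition replacement := {j : 'I_Nblocks & (M (block_val j) * M (block_val j))%type}.

(* [is_replacement m x m'], with x = (j, (p, q)), means m' = m_(j,p,q). *)
Definition is_replacement (m : multi_class) (x : replacement)
    (m' : multi_class) : bool :=
  let: existT j (p, q) := x in
  [&& p != q, (0 < lambda_class m p)%N &
    [forall j', forall p' : M (block_val j'),
      lambda_class m' p' ==
        (lambda_class m p' - (Tagged M p' == Tagged M p)
         + (Tagged M p' == Tagged M q))%N]].

End Indices.
Arguments lambda_class {dL dM calL M N l} m {j} p.

Section EquivariantFunctions.
Context {R : realType} {k k0 : scalar_kind} {n : nat}.
Local Notation K := (base_field R k).
Variables (G : set 'M[base_field R k0]_n).
Context {Ndim : nat} {Omega : Type} {F : comAlgType K}.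
Variables (X : 'I_Ndim -> 'M[base_field R k0]_n).
Variables (act : 'M[base_field R k0]_n -> Omega -> Omega).
Context {dL dM : Order.disp_t} {calL : orderType dL}.
Context {M : calL -> finOrderType dM}.
Variables (phi : forall l : calL, M l -> Omega -> F).
Variables (rho : forall l : calL, 'M[base_field R k0]_n -> M l -> M l -> K).

Definition orthonormal_family (ip : (Omega -> F) -> (Omega -> F) -> K) : Prop :=
  forall x y : {l : calL & M l},
    ip (phi (tagged x)) (phi (tagged y)) = (x == y)%:R.

Definition stable_with_representation : Prop :=
  forall (l : calL) g, G g -> forall (m : M l) (r : Omega),
    phi m (act g r) = \sum_(m' : M l) rho g m m' *: phi m' r.

Definition varrho (l : calL) (d : 'I_Ndim) (m m' : M l) : K :=
  real_derivative0 (fun t : R => rho (expm (of_real k0 t *: X d)) m m').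

Section FixedN.
Context {N : nat}.

Definition tensor (f : 'I_N -> Omega -> F) : ('I_N -> Omega) -> F :=
  fun r => \prod_(i < N) f i (r i).

Definition tensor_scalar_product
    (H : set (Omega -> F)) (ip : (Omega -> F) -> (Omega -> F) -> K)
    (HN : set (('I_N -> Omega) -> F))
    (ipN : (('I_N -> Omega) -> F) -> (('I_N -> Omega) -> F) -> K) : Prop :=
  scalar_product HN ipN /\
  forall f g : 'I_N -> Omega -> F, (forall i, H (f i)) -> (forall i, H (g i)) ->
    [/\ HN (tensor f), HN (tensor g)
      & ipN (tensor f) (tensor g) = \prod_(i < N) ip (f i) (g i)].

Variable l : 'I_N -> calL.

Definition phibar (m : multi_index M l) : ('I_N -> Omega) -> F :=
  fun r => \prod_(i < N) \sum_(a < N) phi (m i) (r a).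

Lemma phibar_same_class (m m' : multi_index M l) :
  same_class m m' -> phibar m' = phibar m.
Proof.
case/existsP=> s /andP[_ /forallP sm]; apply/funext => r.
pose f (x : {x : calL & M x}) := \sum_(a < N) phi (tagged x) (r a).
rewrite /phibar [RHS](reindex_inj (@perm_inj _ s)) /=.
by apply: eq_bigr => i _; rewrite -[LHS]/(f (label m' i)) (eqP (sm i)).
Qed.

Definition phibar_class (m : multi_class M l) : ('I_N -> Omega) -> F :=
  phibar (repr m).

Definition Vbar : set (('I_N -> Omega) -> F) :=
  [set f | exists a : multi_index M l -> K, f = \sum_m a m *: phibar m].

Definition Vbar_equivariant (L : calL) : set (M L -> ('I_N -> Omega) -> F) :=
  [set f | (forall kk, Vbar (f kk)) /\
    forall g, G g -> forall (r : 'I_N -> Omega) kk,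
      f kk (fun i => act g (r i)) = \sum_(kk' : M L) rho g kk kk' *: f kk' r].

Variable L : calL.
Local Notation I := (multi_class M l * M L)%type.

Definition M_entry (d : 'I_Ndim) (x y : I) : K :=
  let: (m, kk) := x in let: (m', kk') := y in
  if m == m' then
    if kk == kk' then
      \sum_(j < N) varrho d (repr m j) (repr m j) - varrho d kk kk
    else - varrho d kk kk'
  else if kk == kk' then
    if [pick z | is_replacement m z m'] is Some (existT j (p, q)) then
      (lambda_class m' q)%:R * varrho d q p
    else 0
  else 0.

Definition M_block (d : 'I_Ndim) : 'M[K]_(#|{: I}|, #|{: I}|) :=
  \matrix_(x, y) M_entry d (enum_val x) (enum_val y).

Definition M_stacked : 'M[K]_(\sum_(d < Ndim) #|{: I}|, #|{: I}|) :=
  \mxcol_(d < Ndim) M_block d.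

Definition kerM : {vspace 'cV[K]_#|{: I}|} :=
  lker (linfun (mulmx M_stacked : 'cV[K]_#|{: I}| -> 'cV[K]_(\sum_(d < Ndim) #|{: I}|))).

Definition equivariant_of_coef (c : 'cV[K]_#|{: I}|) :
    M L -> ('I_N -> Omega) -> F :=
  fun kk => \sum_(m : multi_class M l) c (enum_rank (m, kk)) 0 *: phibar_class m.

End FixedN.
End EquivariantFunctions.
Arguments Vbar_equivariant {R k k0 n} G {Omega F} act {dL dM calL M} phi rho {N} l L.

(* Main.v *)
Require Import Defs.
From HB Require Import structures.
From mathcomp Require Import all_boot all_order perm all_algebra complex.
From mathcomp Require Import all_classical all_reals all_analysis.
From mathcomp Require Import ring lra zify.

Set Implicit Arguments.
Unset Strict Implicit.
Unset Printing Implicit Defensive.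

Import Order.TTheory GRing.Theory Num.Theory.
Import numFieldNormedType.Exports.

Local Open Scope classical_set_scope.
Local Open Scope ring_scope.

(** The map sending a coefficient vector c to its function f_c is a linear bijection
   from K^(classes x M_L) onto the tuples of functions in the span of the symmetric
   products, so the theorem amounts to two facts: this map is injective, and f_c is
   equivariant exactly when c lies in the kernel of the stacked matrix.

   Injectivity ([phibar_class_free]). Expanding a symmetric product gives terms that
   evaluate several factors at the same point, about which orthonormality says
   nothing. Evaluated at a tuple in which the points r_1, ..., r_N occur with
   multiplicities x_1, ..., x_N, a symmetric product becomes a form of degree N in x.
   Its values on the integer points of the simplex |x| = N determine its coefficient
   of x_1 ... x_N ([multilinear_coefficient]), and this coefficient is the sum over
   the permutations s of the products of phi_(m_i) (r_(s i)). These sums are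
   combinations of tensor products of distinct positions, and the scalar product
   separates the classes.

   Equivariance and kernel ([kerM_equivariant]). By injectivity, a group element g acts
   on coefficient vectors through a matrix, and f_c is equivariant at g iff c is fixed.
   Along t |-> exp (t X_d) these matrices form a continuous one-parameter group, hence
   equal exp (t B) ([one_parameter_group]), and the product rule identifies B with the
   block M_d of the statement: differentiating a product of representation matrices
   lets exactly one index of the multi-index change, which is why only the classes
   reached by one replacement q -> p occur, once for each of the lambda_q positions
   carrying q ([class_derivative_sum], [coef_action_flow]). So M_d c = 0 for all d iff
   f_c is equivariant along every exp (t X_d).

   It remains to pass from these one-parameter groups to G
   ([Lie_generators_closed_subgroup]). The elements of G at which f_c is equivariant
   form a closed subgroup S. Its Lie algebra contains every X_d, hence is that of G.
   Then S is open in G: otherwise some g in G outside S are arbitrarily close to 1;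
   multiplying them by nearly optimal elements of S makes their distance to 1 minimal
   up to a factor 2, a limit of the normalised differences with 1 is a vector Y of
   Lie(G) = Lie(S), and a further multiplication by exp (- eps Y) in S beats the
   minimum. Connectedness gives S = G. All limits of this kind, including sums and
   brackets in the Lie algebra and the differentiability of one-parameter groups, come
   from one estimate, (1 + eps Y')^m -> exp (s Y) when Y' -> Y, eps -> 0 and
   m eps -> s ([mcvg_power]), and from compactness along ultrafilters, which replaces
   the extraction of subsequences. *)

(** * The scalar field and its real-valued modulus *)

Section Scalars.
Variables (R : realType) (k : scalar_kind).
Local Notation K := (base_field R k).

Lemma of_real_is_zmod_morphism : zmod_morphism (@of_real R k).
Proof. by case: k => // x y; rewrite /of_real rmorphB. Qed.

Lemma of_real_is_monoid_morphism : monoid_morphism (@of_real R k).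
Proof.
by case: k; split=> //; rewrite /of_real ?rmorph1// => x y; rewrite rmorphM.
Qed.

HB.instance Definition _ := GRing.isZmodMorphism.Build R K (@of_real R k)
  (@of_real_is_zmod_morphism).
HB.instance Definition _ := GRing.isMonoidMorphism.Build R K (@of_real R k)
  (@of_real_is_monoid_morphism).

Lemma ler_of_real (x y : R) : (of_real k x <= of_real k y) = (x <= y).
Proof. by case: k => //=; rewrite lecR. Qed.

Lemma ltr_of_real (x y : R) : (of_real k x < of_real k y) = (x < y).
Proof. by case: k => //=; rewrite ltcR. Qed.

Lemma of_real_eq0 (x : R) : (of_real k x == 0) = (x == 0).
Proof. by rewrite fmorph_eq0. Qed.

(** The library norm of a complex number is again a complex number; estimates are
   carried out with this copy of it in the ordered field R. *)
Definition absK : K -> R :=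
  match k as k0 return base_field R k0 -> R with
  | RealScalars => fun x => `|x| | ComplexScalars => fun z => ComplexField.Normc.normc z end.

Lemma absKE (x : K) : of_real k (absK x) = `|x|.
Proof. by rewrite /absK; case: k x. Qed.

Lemma absK_real (x : R) : absK (of_real k x) = `|x|.
Proof.
rewrite /absK; case: k => //=.
by rewrite expr0n/= addr0 sqrtr_sqr.
Qed.

Lemma absK_ge0 (x : K) : 0 <= absK x.
Proof. by rewrite -ler_of_real absKE rmorph0. Qed.

Lemma absKD (x y : K) : absK (x + y) <= absK x + absK y.
Proof. by rewrite -ler_of_real rmorphD/= !absKE ler_normD. Qed.

Lemma absKM (x y : K) : absK (x * y) = absK x * absK y.
Proof.
by apply: (fmorph_inj (@of_real R k)); rewrite /= rmorphM/= !absKE normrM.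
Qed.

Lemma absK0 : absK 0 = 0.
Proof. by apply: (fmorph_inj (@of_real R k)); rewrite /= absKE normr0 rmorph0. Qed.

Lemma absK1 : absK 1 = 1.
Proof. by apply: (fmorph_inj (@of_real R k)); rewrite /= absKE normr1 rmorph1. Qed.

Lemma absKN (x : K) : absK (- x) = absK x.
Proof. by apply: (fmorph_inj (@of_real R k)); rewrite /= !absKE normrN. Qed.

Lemma absK_eq0 (x : K) : absK x = 0 -> x = 0.
Proof.
by move=> x0; apply/eqP; rewrite -normr_eq0 -absKE x0 rmorph0.
Qed.

Lemma absK_sum (I : Type) (r : seq I) (P : pred I) (F : I -> K) :
  absK (\sum_(i <- r | P i) F i) <= \sum_(i <- r | P i) absK (F i).
Proof.
elim/big_rec2: _ => [|i y x _ IH]; first by rewrite absK0.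
by apply: le_trans (absKD _ _) _; rewrite lerD2l.
Qed.

Lemma absK_invn (j : nat) : absK (j%:R)^-1 = (j%:R)^-1.
Proof.
by apply: (fmorph_inj (@of_real R k)); rewrite /= absKE normfV normr_nat fmorphV rmorph_nat.
Qed.

Lemma gt0_of_real (e : K) : 0 < e -> exists2 x : R, 0 < x & e = of_real k x.
Proof.
move=> e0; exists (absK e); last by rewrite absKE gtr0_norm.
by rewrite -ltr_of_real absKE rmorph0 gtr0_norm.
Qed.

(** In the complex case the radii of balls range over complex numbers, but the
   positive ones are real. *)
Lemma cvg_absK (T : Type) (F : set_system T) {FF : Filter F} (f : T -> K) (a : K) :
  f t @[t --> F] --> a <-> absK (f t - a) @[t --> F] --> (0 : R).
Proof.
split=> [/cvgrPdist_lt H|/cvgrPdist_lt H]; apply/cvgrPdist_lt => e e0.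
  have e0' : 0 < of_real k e by rewrite -(rmorph0 (@of_real R k)) ltr_of_real.
  apply: filterS (H _ e0') => t.
  by rewrite -normrN opprB -absKE ltr_of_real sub0r normrN ger0_norm ?absK_ge0.
have [x x0 ->] := gt0_of_real e0.
apply: filterS (H _ x0) => t.
by rewrite -[`|a - _|]normrN opprB -absKE ltr_of_real sub0r normrN ger0_norm ?absK_ge0.
Qed.

End Scalars.

(** * Compactness along ultrafilters *)

Section UltraConvergence.
Context {T : Type} (U : set_system T) {UU : UltraFilter U}.

(** A cluster point exists by compactness of segments; along an ultrafilter a cluster
   point is a limit. *)
Lemma ultra_cvg_real (R : realType) (f : T -> R) (b : R) :
  U [set t | `|f t| <= b] -> exists a : R, f t @[t --> U] --> a.
Proof.
move=> fb.
have PF : ProperFilter (f t @[t --> U]) by apply: fmap_proper_filter.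
have /(_ _ PF)[|p [_ pc]] := @segment_compact R (- b) b.
  apply: (@filterS _ U _ [set t | `|f t| <= b]) fb => t /=.
  by rewrite in_itv/= ler_norml.
exists p => B pB.
have [//|nB] := in_ultra_setVsetC (f @^-1` B) UU.
have [x [nBx Bx]] : (~` B) `&` B !=set0 by apply: pc.
by [].
Qed.

Lemma ultra_cvg_scalar (R : realType) (k : scalar_kind)
    (f : T -> base_field R k) (b : R) :
  U [set t | absK (f t) <= b] -> exists a, absK (f t - a) @[t --> U] --> (0 : R).
Proof.
case: k f => f fb.
  have [a fa] := ultra_cvg_real fb; exists a.
  exact/(@cvg_absK R RealScalars T U _ f a).
have le_re (z : R[i]) : `|complex.Re z| <= ComplexField.Normc.normc z :> R.
  case: z => x y /=; rewrite -sqrtr_sqr ler_wsqrtr//.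
  by rewrite lerDl sqr_ge0.
have le_im (z : R[i]) : `|complex.Im z| <= ComplexField.Normc.normc z :> R.
  case: z => x y /=; rewrite -sqrtr_sqr ler_wsqrtr//.
  by rewrite lerDr sqr_ge0.
have [a ra] : exists a : R, complex.Re (f t) @[t --> U] --> a.
  by apply: (@ultra_cvg_real _ _ b); apply: filterS fb => t /=; apply: le_trans.
have [c ic] : exists a : R, complex.Im (f t) @[t --> U] --> a.
  by apply: (@ultra_cvg_real _ _ b); apply: filterS fb => t /=; apply: le_trans.
exists (Complex a c); rewrite /absK/=.
have rc : `|complex.Re (f t) - a| + `|complex.Im (f t) - c| @[t --> U] --> (0 : R).
  rewrite -[0]addr0; apply: cvgD.
    by rewrite -(@normr0 _ R) -(subrr a); apply: cvg_norm; apply: cvgB => //; exact: cvg_cst.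
  by rewrite -(@normr0 _ R) -(subrr c); apply: cvg_norm; apply: cvgB => //; exact: cvg_cst.
apply: (squeeze_cvgr _ (cvg_cst 0) rc).
apply: nearW => t; rewrite (absK_ge0 (k := ComplexScalars))/=.
case: (f t) => x y /=; move: (x - a) (y - c) => {}x {}y.
rewrite -[leRHS]ger0_norm ?addr_ge0// -sqrtr_sqr ler_wsqrtr//.
rewrite sqrrD !real_normK ?num_real//.
by rewrite lerD2r lerDl mulrn_wge0// mulr_ge0.
Qed.

End UltraConvergence.

(** * A submultiplicative norm and convergence of matrices *)

Section MatrixNorm.
Variables (R : realType) (k : scalar_kind) (n : nat).
Local Notation K := (base_field R k).
Implicit Types A B : 'M[K]_n.

(** The maximal absolute row sum. Unlike the sup norm of the entries it is
   submultiplicative, and 1 has norm at most 1, so that powers of A are bounded by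
   powers of the norm of A. *)
Definition mnorm A : R := \big[Num.max/0]_i \sum_j absK (A i j).

Lemma mnorm_ge0 A : 0 <= mnorm A.
Proof. by apply: bigmax_ge_id. Qed.

Lemma mnorm_le A b :
  0 <= b -> (forall i, \sum_j absK (A i j) <= b) -> mnorm A <= b.
Proof. by move=> b0 H; apply/bigmax_leP; split. Qed.

Lemma row_le_mnorm A i : \sum_j absK (A i j) <= mnorm A.
Proof. exact: (le_bigmax_cond _ (fun i => \sum_j absK (A i j))). Qed.

Lemma entry_le_mnorm A i j : absK (A i j) <= mnorm A.
Proof.
apply: le_trans (row_le_mnorm A i); rewrite (bigD1 j)//= lerDl sumr_ge0// => ? _.
exact: absK_ge0.
Qed.

Lemma mnorm_le_sum A : mnorm A <= \sum_i \sum_j absK (A i j).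
Proof.
have s0 i : 0 <= \sum_j absK (A i j) by apply: sumr_ge0 => ? _; exact: absK_ge0.
apply: mnorm_le => [|i]; first by apply: sumr_ge0 => i _.
by rewrite [leRHS](bigD1 i)//= lerDl sumr_ge0.
Qed.

Lemma mnormD A B : mnorm (A + B) <= mnorm A + mnorm B.
Proof.
apply: mnorm_le => [|i]; first by rewrite addr_ge0 ?mnorm_ge0.
apply: le_trans (lerD (row_le_mnorm A i) (row_le_mnorm B i)).
by rewrite -big_split/= ler_sum// => j _; rewrite mxE absKD.
Qed.

Lemma mnormN A : mnorm (- A) = mnorm A.
Proof.
by apply: eq_bigr => i _; apply: eq_bigr => j _; rewrite mxE absKN.
Qed.

Lemma mnormBC A B : mnorm (A - B) = mnorm (B - A).
Proof. by rewrite -mnormN opprB. Qed.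

Lemma mnorm0 : mnorm 0 = 0.
Proof.
apply/eqP; rewrite eq_le mnorm_ge0 andbT; apply: mnorm_le => // i.
by rewrite big1// => j _; rewrite mxE absK0.
Qed.

Lemma mnorm_eq0 A : mnorm A = 0 -> A = 0.
Proof.
move=> A0; apply/matrixP => i j; rewrite mxE; apply: absK_eq0; apply/eqP.
by rewrite eq_le absK_ge0 andbT -A0 entry_le_mnorm.
Qed.

Lemma mnorm1 : mnorm 1 <= 1.
Proof.
apply: mnorm_le => // i; rewrite (bigD1 i)//= big1 ?mxE ?eqxx ?absK1 ?addr0//.
by move=> j ji; rewrite mxE eq_sym (negPf ji) absK0.
Qed.

Lemma mnormM A B : mnorm (A * B) <= mnorm A * mnorm B.
Proof.
apply: mnorm_le => [|i]; first by rewrite mulr_ge0 ?mnorm_ge0.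
apply: (@le_trans _ _ (\sum_p absK (A i p) * \sum_j absK (B p j))).
  under [leRHS]eq_bigr do rewrite mulr_sumr.
  rewrite exchange_big ler_sum//= => j _; rewrite mxE.
  apply: le_trans (absK_sum _ _ _) _.
  by apply: ler_sum => p _; rewrite absKM.
apply: (@le_trans _ _ (\sum_p absK (A i p) * mnorm B)).
  by apply: ler_sum => p _; rewrite ler_wpM2l ?absK_ge0 ?row_le_mnorm.
by rewrite -mulr_suml ler_wpM2r ?mnorm_ge0 ?row_le_mnorm.
Qed.

Lemma mnormZ (c : K) A : mnorm (c *: A) <= absK c * mnorm A.
Proof.
apply: mnorm_le => [|i]; first by rewrite mulr_ge0 ?mnorm_ge0 ?absK_ge0.
under eq_bigr do rewrite mxE absKM.
by rewrite -mulr_sumr ler_wpM2l ?absK_ge0 ?row_le_mnorm.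
Qed.

Lemma mnormX A j : mnorm (A ^+ j) <= mnorm A ^+ j.
Proof.
elim: j => [|j IH]; first by rewrite !expr0 mnorm1.
rewrite !exprS; apply: le_trans (mnormM _ _) _.
by rewrite ler_wpM2l ?mnorm_ge0.
Qed.

Lemma mnorm_sum (I : Type) (r : seq I) (P : pred I) (F : I -> 'M[K]_n) :
  mnorm (\sum_(i <- r | P i) F i) <= \sum_(i <- r | P i) mnorm (F i).
Proof.
elim/big_rec2: _ => [|i y x _ IH]; first by rewrite mnorm0.
by apply: le_trans (mnormD _ _) _; rewrite lerD2l.
Qed.

Lemma mnorm_ball A B (x : R) : 0 < x -> mnorm (A - B) < x -> ball B (of_real k x) A.
Proof.
move=> x0 Ax; split; first by rewrite -(rmorph0 (@of_real R k)) ltr_of_real.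
move=> i j; rewrite -ball_normE/= distrC -absKE ltr_of_real.
by apply: le_lt_trans Ax; have := entry_le_mnorm (A - B) i j; rewrite !mxE.
Qed.

End MatrixNorm.

Lemma cvg0_le (R : realType) (T : Type) (F : set_system T) {FF : Filter F}
    (f g : T -> R) : (\forall t \near F, 0 <= f t <= g t) ->
  g t @[t --> F] --> (0 : R) -> f t @[t --> F] --> (0 : R).
Proof. by move=> fg g0; apply: (squeeze_cvgr fg (cvg_cst 0) g0). Qed.

Lemma cvg0_sum (R : realType) (T : Type) (F : set_system T) {FF : Filter F}
    (I : Type) (r : seq I) (f : I -> T -> R) :
  (forall i, f i t @[t --> F] --> (0 : R)) ->
  \sum_(i <- r) f i t @[t --> F] --> (0 : R).
Proof.
move=> f0; elim: r => [|i r IH].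
  by under eq_fun do rewrite big_nil; exact: cvg_cst.
under eq_fun do rewrite big_cons.
have := cvgD (f0 i) IH; rewrite addr0; exact.
Qed.

Section MatrixConvergence.
Variables (R : realType) (k : scalar_kind) (n : nat).
Local Notation K := (base_field R k).
Context {T : Type} (F : set_system T) {FF : Filter F}.
Implicit Types (A B : T -> 'M[K]_n) (a b : 'M[K]_n).

(** The filter is arbitrary: below it is an ultrafilter on the group, on the reals or
   on nat, as well as a filter of neighbourhoods. *)
Definition mcvg A a := mnorm (A t - a) @[t --> F] --> (0 : R).

Lemma mcvg_le A a (g : T -> R) : (\forall t \near F, mnorm (A t - a) <= g t) ->
  g t @[t --> F] --> (0 : R) -> mcvg A a.
Proof.
move=> Ag; apply: cvg0_le; apply: filterS Ag => t ->.
by rewrite mnorm_ge0.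
Qed.

Lemma mcvg_cst a : mcvg (fun=> a) a.
Proof. by rewrite /mcvg subrr mnorm0; apply: cvg_cst. Qed.

Lemma mcvg_near A B a : (\forall t \near F, A t = B t) -> mcvg A a -> mcvg B a.
Proof.
move=> AB; apply: mcvg_le; apply: filterS AB => t ->.
exact: lexx.
Qed.

Lemma mcvgD A B a b : mcvg A a -> mcvg B b -> mcvg (fun t => A t + B t) (a + b).
Proof.
move=> Aa Bb.
apply: (@mcvg_le _ _ (fun t => mnorm (A t - a) + mnorm (B t - b))).
  by apply: nearW => t; rewrite opprD addrACA mnormD.
by rewrite -[0]addr0; apply: cvgD.
Qed.

Lemma mcvgN A a : mcvg A a -> mcvg (fun t => - A t) (- a).
Proof. by apply: mcvg_le; apply: nearW => t; rewrite -opprD mnormN. Qed.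

Lemma mcvgB A B a b : mcvg A a -> mcvg B b -> mcvg (fun t => A t - B t) (a - b).
Proof. by move=> Aa Bb; apply: mcvgD Aa (mcvgN Bb). Qed.

Lemma mcvg_norm A a : mcvg A a -> mnorm (A t) @[t --> F] --> mnorm a.
Proof.
move=> Aa; apply/cvgrPdist_lt => e e0; move/cvgrPdist_lt: Aa => /(_ _ e0).
apply: filterS => t; rewrite sub0r normrN ger0_norm ?mnorm_ge0//.
apply: le_lt_trans; rewrite ler_norml; apply/andP; split.
  rewrite lerNl opprB lerBlDr.
  by rewrite -{1}[A t](subrK a) mnormD.
by rewrite lerBlDr mnormBC -{1}[a](subrK (A t)) mnormD.
Qed.

Lemma mcvgM A B a b : mcvg A a -> mcvg B b -> mcvg (fun t => A t * B t) (a * b).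
Proof.
move=> Aa Bb.
apply: (@mcvg_le _ _ (fun t =>
  mnorm (A t - a) * mnorm (B t) + mnorm a * mnorm (B t - b))).
  apply: nearW => t.
  rewrite (_ : A t * B t - _ = (A t - a) * B t + a * (B t - b)).
    by apply: le_trans (mnormD _ _) _; rewrite lerD ?mnormM.
  by rewrite mulrBl mulrBr subrKA.
rewrite (_ : 0 = 0 * mnorm b + mnorm a * 0); last by rewrite mul0r mulr0 addr0.
apply: cvgD; first by apply: cvgM => //; apply: mcvg_norm.
by apply: cvgM => //; apply: cvg_cst.
Qed.

Lemma mcvgZ (c : T -> R) (c0 : R) A a : c t @[t --> F] --> c0 -> mcvg A a ->
  mcvg (fun t => of_real k (c t) *: A t) (of_real k c0 *: a).
Proof.
move=> cc Aa.
apply: (@mcvg_le _ _ (fun t =>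
  `|c t - c0| * mnorm (A t) + `|c0| * mnorm (A t - a))).
  apply: nearW => t.
  rewrite (_ : _ - _ = of_real k (c t - c0) *: A t + of_real k c0 *: (A t - a)).
    apply: le_trans (mnormD _ _) _.
    by rewrite -!(absK_real k) lerD ?mnormZ.
  by rewrite rmorphB/= scalerBl scalerBr subrKA.
rewrite (_ : 0 = `|c0 - c0| * mnorm a + `|c0| * 0); last first.
  by rewrite subrr normr0 mul0r mulr0 addr0.
apply: cvgD; apply: cvgM => //; try exact: cvg_cst; last exact: mcvg_norm.
by apply: cvg_norm; apply: cvgB => //; exact: cvg_cst.
Qed.

Lemma mcvg_entry A a i j : mcvg A a ->
  absK (A t i j - a i j) @[t --> F] --> (0 : R).
Proof.
apply: cvg0_le; apply: nearW => t; rewrite absK_ge0/=.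
by have := entry_le_mnorm (A t - a) i j; rewrite !mxE.
Qed.

Lemma mcvg_entries A a : (forall i j, absK (A t i j - a i j) @[t --> F] --> (0 : R)) ->
  mcvg A a.
Proof.
move=> H; apply: (@mcvg_le _ _ (fun t => \sum_i \sum_j absK (A t i j - a i j))).
  apply: nearW => t; apply: le_trans (mnorm_le_sum _) _.
  by apply: ler_sum => i _; apply: ler_sum => j _; rewrite !mxE.
by apply: cvg0_sum => i; apply: cvg0_sum.
Qed.

Lemma cvg_mcvg A a : A t @[t --> F] --> a <-> mcvg A a.
Proof.
split=> [Aa|Aa].
  apply: mcvg_entries => i j.
  apply/(@cvg_absK R k T F _ (fun t => A t i j)).
  exact: (cvg_comp _ _ Aa (@coord_continuous K n n i j a)).
apply/cvg_ballP => e e0; have [x x0 ->] := gt0_of_real e0.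
move/cvgrPdist_lt: Aa => /(_ _ x0); apply: filterS => t.
rewrite sub0r normrN ger0_norm ?mnorm_ge0// => Ax.
exact: mnorm_ball.
Qed.

End MatrixConvergence.

Section MatrixLimits.
Variables (R : realType) (k : scalar_kind) (n : nat).
Local Notation K := (base_field R k).

Lemma mcvg_comp {S T : Type} (F : set_system S) (G : set_system T) (f : S -> T)
    (A : T -> 'M[K]_n) a : f x @[x --> F] --> G ->
  mcvg G A a -> mcvg F (fun x => A (f x)) a.
Proof. by move=> fG Aa; apply: (cvg_comp _ _ fG Aa). Qed.

Lemma mcvg_unique {T : Type} (F : set_system T) {FF : ProperFilter F}
    (A : T -> 'M[K]_n) a b : mcvg F A a -> mcvg F A b -> a = b.
Proof.
move=> Aa Ab; apply/eqP; rewrite -subr_eq0; apply/eqP; apply: mnorm_eq0.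
have : mcvg F (fun t => A t - A t) (a - b) by apply: mcvgB.
move=> /mcvg_norm H.
rewrite (_ : (fun t => _) = fun=> 0) in H; last first.
  by apply/funext => t; rewrite subrr mnorm0.
by rewrite -(cvg_lim (@norm_hausdorff _ _) H) lim_cst//; exact: norm_hausdorff.
Qed.

Lemma ultra_mcvg {T : Type} (U : set_system T) {UU : UltraFilter U}
    (A : T -> 'M[K]_n) (b : R) :
  U [set t | mnorm (A t) <= b] -> exists a, mcvg U A a.
Proof.
move=> Ab.
have H (ij : 'I_n * 'I_n) :
    exists a, absK (A t ij.1 ij.2 - a) @[t --> U] --> (0 : R).
  apply: (@ultra_cvg_scalar _ U UU R k (fun t => A t ij.1 ij.2) b).
  by apply: filterS Ab => t /=; apply: le_trans; exact: entry_le_mnorm.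
have [a aP] := choice H.
exists (\matrix_(i, j) a (i, j)); apply: mcvg_entries => i j.
by rewrite mxE; exact: aP (i, j).
Qed.

Lemma nbhs_mnorm (a : 'M[K]_n) (B : set 'M[K]_n) :
  nbhs a B <-> exists2 e : R, 0 < e & forall y, mnorm (y - a) < e -> B y.
Proof.
split=> [/nbhs_ballP[e e0 aB]|[e e0 H]].
  have [x x0 ex] := gt0_of_real e0.
  by exists x => // y yx; apply: aB; rewrite ex; exact: mnorm_ball.
have : mcvg (nbhs a) id a by apply/cvg_mcvg.
move/cvgrPdist_lt => /(_ _ e0); apply: filterS => y.
by rewrite sub0r normrN ger0_norm ?mnorm_ge0//; exact: H.
Qed.

End MatrixLimits.

(** * The matrix exponential *)

Lemma cvg_le_const (R : realType) (T : Type) (F : set_system T) {FF : ProperFilter F}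
    (f : T -> R) (l b : R) :
  f t @[t --> F] --> l -> (\forall t \near F, f t <= b) -> l <= b.
Proof.
move=> fl fb; rewrite -(cvg_lim (@Rhausdorff R) fl); apply: limr_le => //.
by apply/cvg_ex; exists l.
Qed.

(** Summing over the triangle i + j < N by antidiagonals: the shape in which the
   coefficients of a product of two power series appear. *)
Lemma sum_antidiagonal (V : zmodType) (f : nat -> nat -> V) N :
  \sum_(0 <= m < N) \sum_(0 <= i < m.+1) f i (m - i)%N =
  \sum_(0 <= i < N) \sum_(0 <= j < N - i) f i j.
Proof.
elim: N => [|N IH]; first by rewrite !big_geq.
rewrite big_nat_recr//= IH [RHS]big_nat_recr//= subSnn big_nat1.
rewrite (big_nat_recr N)//= subnn addrA; congr (_ + _).
rewrite -big_split/=; apply: eq_big_nat => i /andP[_ iN].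
by rewrite subSn 1?ltnW// big_nat_recr.
Qed.

Lemma sum_square_sub_triangle (V : zmodType) (f : nat -> nat -> V) N :
  \sum_(0 <= i < N) \sum_(0 <= j < N) f i j -
  \sum_(0 <= m < N) \sum_(0 <= i < m.+1) f i (m - i)%N =
  \sum_(0 <= i < N) \sum_(N - i <= j < N) f i j.
Proof.
rewrite sum_antidiagonal -sumrB; apply: eq_big_nat => i /andP[_ iN].
by rewrite (@big_cat_nat _ _ _ (N - i)%N 0 N)//= ?leq_subr// [X in X - _]addrC addrK.
Qed.

(** The coefficient of A^(i+j) in exp (s A) exp (t A). *)
Definition exp_coef2 (L : numFieldType) (s t : L) i j : L :=
  s ^+ i * t ^+ j * (i`!%:R)^-1 * (j`!%:R)^-1.

Lemma sum_exp_coef2 (L : numFieldType) (s t : L) m :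
  \sum_(0 <= i < m.+1) exp_coef2 s t i (m - i)%N = (s + t) ^+ m * (m`!%:R)^-1.
Proof.
rewrite [s + t]addrC exprDn mulr_suml big_mkord; apply: eq_bigr => i _.
rewrite /exp_coef2 -[_ *+ 'C(_, _)]mulr_natr [t ^+ _ * s ^+ _]mulrC -!mulrA; congr (_ * (_ * _)).
have im : (i <= m)%N by rewrite -ltnS.
have f0 j : j`!%:R != 0 :> L by rewrite pnatr_eq0 -lt0n fact_gt0.
rewrite -(bin_fact im) !natrM; field.
by rewrite !f0 pnatr_eq0 -lt0n bin_gt0 im.
Qed.

Section MatrixExponential.
Variables (R : realType) (k : scalar_kind) (n : nat).
Local Notation K := (base_field R k).
Implicit Types A : 'M[K]_n.

Definition expm_partial A : nat -> 'M[K]_n :=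
  series (fun j : nat => (j`!%:R : K)^-1 *: A ^+ j).

Local Notation exp_partial := (fun a : R => series (exp_coeff a)).

Lemma expm_partial0 A : expm_partial A 0 = 0.
Proof. by rewrite /expm_partial /series/= big_geq. Qed.

Lemma exp_partial0 (a : R) : exp_partial a 0 = 0.
Proof. by rewrite /series/= big_geq. Qed.

Lemma mnorm_expm_term A j :
  mnorm ((j`!%:R : K)^-1 *: A ^+ j) <= exp_coeff (mnorm A) j.
Proof.
apply: le_trans (mnormZ _ _) _; rewrite absK_invn /exp_coeff/= mulrC.
by rewrite ler_wpM2r ?invr_ge0 ?ler0n ?mnormX.
Qed.

Lemma expm_partial_sub A M N : (M <= N)%N ->
  mnorm (expm_partial A N - expm_partial A M) <=
  exp_partial (mnorm A) N - exp_partial (mnorm A) M.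
Proof.
move=> MN; rewrite /expm_partial !sub_series_geq//.
apply: le_trans (mnorm_sum _ _ _) _.
by apply: ler_sum => j _; exact: mnorm_expm_term.
Qed.

Lemma exp_partial_cvg (a : R) : exp_partial a N @[N --> \oo] --> expR a.
Proof. exact: is_cvg_series_exp_coeff. Qed.

Lemma exp_partial_le (a : R) N : 0 <= a -> exp_partial a N <= expR a.
Proof.
move=> a0; apply: (nondecreasing_cvgn_le (u_ := exp_partial a)) => //.
  apply/nondecreasing_seqP => m; rewrite /series/= big_nat_recr//= lerDl.
  exact: exp_coeff_ge0.
exact: is_cvg_series_exp_coeff.
Qed.

(** The partial sums are bounded, hence converge along an ultrafilter finer than the
   filter of infinity; comparison with the real exponential series bounds the distance
   to this limit. *)
Lemma expm_partial_limit A : exists B, forall N,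
  mnorm (expm_partial A N - B) <= expR (mnorm A) - exp_partial (mnorm A) N.
Proof.
have [U [UU oU]] := ultraFilterLemma (@eventually_filter).
have bd N : mnorm (expm_partial A N) <= expR (mnorm A).
  have := expm_partial_sub A (leq0n N).
  rewrite expm_partial0 exp_partial0 !subr0.
  by move=> /le_trans; apply; exact: exp_partial_le (mnorm_ge0 _).
have [B AB] : exists B, mcvg U (expm_partial A) B.
  by apply: (@ultra_mcvg R k n nat U UU _ (expR (mnorm A))); apply: nearW.
exists B => N.
have H : mnorm (expm_partial A N - expm_partial A M) @[M --> U] -->
    mnorm (expm_partial A N - B).
  by apply: mcvg_norm; apply: mcvgB AB; exact: mcvg_cst.
apply: (cvg_le_const H); apply: oU; exists N => // M/= NM.
rewrite mnormBC; apply: le_trans (expm_partial_sub A NM) _.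
by rewrite lerD2r exp_partial_le ?mnorm_ge0.
Qed.

Lemma expm_partial_cvg A : mcvg \oo (expm_partial A) (expm A).
Proof.
have [B AB] := expm_partial_limit A.
suff H : mcvg \oo (expm_partial A) B.
  rewrite /expm -/(expm_partial A).
  by move/cvg_mcvg: (H) => /cvg_lim ->//; exact: norm_hausdorff.
apply: (@mcvg_le _ _ _ _ _ _ _ _ (fun N => expR (mnorm A) - exp_partial (mnorm A) N)).
  by apply: nearW.
rewrite -(subrr (expR (mnorm A))); apply: cvgB; first exact: cvg_cst.
exact: exp_partial_cvg.
Qed.

Lemma mnorm_expm_tail A N :
  mnorm (expm A - expm_partial A N) <= expR (mnorm A) - exp_partial (mnorm A) N.
Proof.
have [B AB] := expm_partial_limit A.
suff -> : expm A = B by rewrite mnormBC.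
apply: mcvg_unique (expm_partial_cvg A) _.
apply: (@mcvg_le _ _ _ _ _ _ _ _ (fun N => expR (mnorm A) - exp_partial (mnorm A) N)).
  by apply: nearW.
rewrite -(subrr (expR (mnorm A))); apply: cvgB; first exact: cvg_cst.
exact: exp_partial_cvg.
Qed.

Lemma mnorm_expm A : mnorm (expm A) <= expR (mnorm A).
Proof.
have := mnorm_expm_tail A 0.
by rewrite expm_partial0 exp_partial0 !subr0.
Qed.

Lemma mnorm_expm_sub1 A : mnorm (expm A - 1) <= expR (mnorm A) - 1.
Proof.
have := mnorm_expm_tail A 1.
by rewrite /expm_partial /series/= !big_nat1 /exp_coeff/= !expr0 !invr1 scale1r mulr1.
Qed.

Lemma mnorm_expm_sub1A A : mnorm (expm A - 1 - A) <= expR (mnorm A) - 1 - mnorm A.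
Proof.
have := mnorm_expm_tail A 2.
rewrite /expm_partial /series/= !big_nat_recr//= !big_geq// !add0r.
rewrite /exp_coeff/= !expr0 !expr1 !invr1 !scale1r !mulr1.
by rewrite !opprD !addrA.
Qed.

Lemma expm0 : expm (0 : 'M[K]_n) = 1.
Proof.
apply/eqP; rewrite -subr_eq0; apply/eqP/mnorm_eq0/eqP.
rewrite eq_le mnorm_ge0 andbT; apply: le_trans (mnorm_expm_sub1 _) _.
by rewrite mnorm0 expR0 subrr.
Qed.

Lemma scaler_exp (c : K) A j : (c *: A) ^+ j = c ^+ j *: A ^+ j.
Proof.
elim: j => [|j IH]; first by rewrite !expr0 scale1r.
by rewrite !exprS IH -[LHS]/((c *: A) *m (c ^+ j *: A ^+ j)) -scalemxAl -scalemxAr scalerA.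
Qed.

Lemma expm_partialM (s t : K) A N :
  expm_partial (s *: A) N * expm_partial (t *: A) N - expm_partial ((s + t) *: A) N =
  \sum_(0 <= i < N) \sum_(N - i <= j < N) exp_coef2 s t i j *: A ^+ (i + j).
Proof.
rewrite -sum_square_sub_triangle; congr (_ - _).
  rewrite /expm_partial /series/= mulr_suml; apply: eq_bigr => i _.
  rewrite mulr_sumr; apply: eq_bigr => j _.
  rewrite !scaler_exp !scalerA exprD.
  rewrite -[LHS]/(_ *m _) -scalemxAl -scalemxAr scalerA; congr (_ *: _).
  by rewrite /exp_coef2; ring.
rewrite /expm_partial /series/=; apply: eq_bigr => m _.
rewrite scaler_exp scalerA mulrC -sum_exp_coef2 scaler_suml.
by apply: eq_big_nat => i /andP[_]; rewrite ltnS => /subnKC ->.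
Qed.

Lemma exp_partialM (s t : R) N :
  exp_partial s N * exp_partial t N - exp_partial (s + t) N =
  \sum_(0 <= i < N) \sum_(N - i <= j < N) exp_coef2 s t i j.
Proof.
rewrite -sum_square_sub_triangle; congr (_ - _).
  rewrite /series/= mulr_suml; apply: eq_bigr => i _.
  rewrite mulr_sumr; apply: eq_bigr => j _.
  by rewrite /exp_coef2 /exp_coeff/=; ring.
rewrite /series/=; apply: eq_bigr => m _.
by rewrite /exp_coeff/= sum_exp_coef2.
Qed.

(** The product of two partial sums differs from the partial sum of the product
   by terms with nonnegative coefficients, so the defect is dominated by the same
   defect for the real exponential, where it tends to 0. *)
Lemma expmD (s t : R) A :
  expm (of_real k (s + t) *: A) = expm (of_real k s *: A) * expm (of_real k t *: A).
Proof.
pose a := mnorm A; pose s' := `|s| * a; pose t' := `|t| * a.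
pose P N := expm_partial (of_real k s *: A) N * expm_partial (of_real k t *: A) N.
have P1 : mcvg \oo P (expm (of_real k s *: A) * expm (of_real k t *: A)).
  by apply: mcvgM; exact: expm_partial_cvg.
have P2 : mcvg \oo (fun N => P N - expm_partial (of_real k (s + t) *: A) N) 0.
  apply: (@mcvg_le _ _ _ _ _ _ _ _
    (fun N => exp_partial s' N * exp_partial t' N - exp_partial (s' + t') N)).
    apply: nearW => N; rewrite subr0 rmorphD expm_partialM exp_partialM.
    apply: le_trans (mnorm_sum _ _ _) _; apply: ler_sum => i _.
    apply: le_trans (mnorm_sum _ _ _) _; apply: ler_sum => j _.
    apply: le_trans (mnormZ _ _) _.
    rewrite /exp_coef2 -!rmorphXn -rmorphM/= !absKM !absK_invn absK_real.
    rewrite normrM !normrX /s' /t' !exprMn.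
    apply: le_trans (ler_wpM2l _ (mnormX A (i + j))) _.
      by rewrite !mulr_ge0 ?invr_ge0.
    by rewrite le_eqVlt; apply/orP; left; apply/eqP; rewrite -/a exprD; ring.
  rewrite -(subrr (expR (s' + t'))) [X in X - _]expRD.
  by apply: cvgB; [apply: cvgM|]; exact: exp_partial_cvg.
apply/eqP; rewrite eq_sym -subr_eq0; apply/eqP.
apply: mcvg_unique P2.
by apply: mcvgB => //; exact: expm_partial_cvg.
Qed.

Lemma expmN (s : R) A : expm (of_real k s *: A) * expm (of_real k (- s) *: A) = 1.
Proof. by rewrite -expmD subrr rmorph0 scale0r expm0. Qed.

Lemma expmMn A (m : nat) : expm A ^+ m = expm (of_real k m%:R *: A).
Proof.
elim: m => [|m IH]; first by rewrite expr0 rmorph0 scale0r expm0.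
rewrite exprSr IH -{2}[A]scale1r -(rmorph1 (@of_real R k)) -expmD.
by rewrite natr1.
Qed.

Lemma mcvg_expm0 {T : Type} (F : set_system T) {FF : Filter F} (A : T -> 'M[K]_n) :
  mcvg F A 0 -> mcvg F (fun t => expm (A t)) 1.
Proof.
move=> A0; apply: (@mcvg_le _ _ _ _ _ _ _ _ (fun t => expR (mnorm (A t)) - 1)).
  by apply: nearW => t; exact: mnorm_expm_sub1.
have H : mnorm (A t) @[t --> F] --> (0 : R).
  by have := mcvg_norm A0; rewrite mnorm0; apply.
rewrite -(subrr (1 : R)); apply: cvgB; last exact: cvg_cst.
have := cvg_comp _ _ H (@continuous_expR R 0).
by rewrite expR0; apply.
Qed.

Lemma mcvg_expm {T : Type} (F : set_system T) {FF : Filter F} (c : T -> R) (s : R) A :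
  c t @[t --> F] --> s ->
  mcvg F (fun t => expm (of_real k (c t) *: A)) (expm (of_real k s *: A)).
Proof.
move=> cs.
have cs0 : mcvg F (fun t => of_real k (c t - s) *: A) 0.
  rewrite (_ : 0 = of_real k (s - s) *: A); last by rewrite subrr rmorph0 scale0r.
  by apply: mcvgZ (mcvg_cst _); apply: cvgB => //; exact: cvg_cst.
have H : mcvg F (fun t => expm (of_real k (c t - s) *: A) * expm (of_real k s *: A))
    (1 * expm (of_real k s *: A)).
  by apply: mcvgM (mcvg_cst _); exact: mcvg_expm0.
rewrite mul1r in H; apply: (mcvg_near _ H); apply: nearW => t.
by rewrite -expmD subrK.
Qed.

End MatrixExponential.

(** * Powers of matrices close to the identity *)

Section RealEstimates.
Variable R : realType.

Lemma expR_le_inv (x : R) : x < 1 -> expR x <= (1 - x)^-1.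
Proof.
move=> x1; rewrite -[expR x]invrK -expRN lef_pV2 ?posrE ?subr_gt0 ?expR_gt0//.
by apply: le_trans (expR_ge1Dx _).
Qed.

(** From exp (- x) >= 1 - x one gets exp x <= 1 / (1 - x). *)
Lemma expR_sub1x_le (x : R) : 0 <= x -> x <= 1 / 2 -> expR x - 1 - x <= 2 * x ^+ 2.
Proof.
move=> x0 x1; have x2 : 0 < 1 - x by lra.
have H := expR_le_inv (x := x) ltac:(lra).
suff : (1 - x)^-1 <= 1 + x + 2 * x ^+ 2 by lra.
by rewrite -div1r ler_pdivrMr//; nra.
Qed.

(** The integer parts of s / eps are the exponents to which [mcvg_power] is applied. *)
Lemma cvg_trunc_mul (T : Type) (F : set_system T) {FF : Filter F} (eps : T -> R) (s : R) :
  0 <= s -> (\forall t \near F, 0 < eps t) -> eps t @[t --> F] --> (0 : R) ->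
  (Num.trunc (s / eps t))%:R * eps t @[t --> F] --> s.
Proof.
move=> s0 e0 ec.
apply: (squeeze_cvgr (f := fun t => s - eps t) (h := fun=> s)).
- apply: filterS e0 => t e0.
  have /truncn_itv/andP[n1 n2] : 0 <= s / eps t by rewrite divr_ge0// ltW.
  rewrite -ler_pdivlMr// n1 andbT lerBlDr -[X in _ + X]mul1r -mulrDl.
  by rewrite -ler_pdivrMr// natr1 ltW.
- by rewrite -[X in _ --> X]subr0; apply: cvgB => //; exact: cvg_cst.
- exact: cvg_cst.
Qed.

End RealEstimates.

Section Powers.
Variables (R : realType) (k : scalar_kind) (n : nat).
Local Notation K := (base_field R k).
Implicit Types A B : 'M[K]_n.

(** Telescoping A^m - B^m; the exponent m instead of m - 1 on the right is harmless as
   M is at least 1. *)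
Lemma mnormB_exp A B (M : R) m : 1 <= M -> mnorm A <= M -> mnorm B <= M ->
  mnorm (A ^+ m - B ^+ m) <= m%:R * mnorm (A - B) * M ^+ m.
Proof.
move=> M1 AM BM; have M0 : 0 <= M by apply: le_trans M1.
elim: m => [|m IH]; first by rewrite !expr0 subrr mnorm0 mul0r mul0r.
rewrite !exprS (_ : _ - _ = A * (A ^+ m - B ^+ m) + (A - B) * B ^+ m); last first.
  by rewrite mulrBr mulrBl subrKA.
apply: le_trans (mnormD _ _) _.
apply: (@le_trans _ _ (M * (m%:R * mnorm (A - B) * M ^+ m) + mnorm (A - B) * M ^+ m)).
  apply: lerD; apply: le_trans (mnormM _ _) _.
    by apply: ler_pM => //; exact: mnorm_ge0.
  rewrite ler_wpM2l ?mnorm_ge0//; apply: le_trans (mnormX _ _) _.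
  by rewrite lerXn2r// ?nnegrE ?mnorm_ge0.
rewrite -natr1.
have P0 : 0 <= mnorm (A - B) * M ^+ m by rewrite mulr_ge0 ?mnorm_ge0 ?exprn_ge0.
rewrite (_ : M * _ = m%:R * (M * (mnorm (A - B) * M ^+ m))); last by ring.
rewrite (_ : (m%:R + 1) * _ * _ = m%:R * (M * (mnorm (A - B) * M ^+ m)) +
  M * (mnorm (A - B) * M ^+ m)); last by ring.
by rewrite lerD2l -[leLHS]mul1r ler_wpM2r.
Qed.

Context {T : Type} (F : set_system T) {FF : Filter F}.
Implicit Types (eps : T -> R) (h : T -> 'M[K]_n).

Definition diff_quotient eps h t := of_real k (eps t)^-1 *: (h t - 1).

Lemma mcvg_diff_quotient_expm eps A : (\forall t \near F, eps t != 0) ->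
  eps t @[t --> F] --> (0 : R) ->
  mcvg F (diff_quotient eps (fun t => expm (of_real k (eps t) *: A))) A.
Proof.
move=> e0 ec; set a := mnorm A.
have ea : `|eps t| * a @[t --> F] --> (0 : R).
  rewrite -[X in _ --> X](mul0r a); apply: cvgM; last exact: cvg_cst.
  by rewrite -(normr0 R); apply: cvg_norm.
apply: (@mcvg_le _ _ _ _ _ _ _ _ (fun t => 2 * (`|eps t| * a) * a)); last first.
  rewrite -[X in _ --> X](mul0r a) -[X in X * a](mulr0 2).
  by apply: cvgM; [apply: cvgM => //|]; exact: cvg_cst.
have small : \forall t \near F, `|eps t| * a <= 1 / 2.
  move/cvgrPdist_lt : ea => /(_ (1 / 2) ltac:(lra)); apply: filterS => t.
  by rewrite sub0r normrN ger0_norm ?mulr_ge0 ?mnorm_ge0// => /ltW.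
apply: filterS2 small e0 => t small e0.
have e1 : 0 < `|eps t| by rewrite normr_gt0.
rewrite /diff_quotient (_ : _ - _ = of_real k (eps t)^-1 *:
   (expm (of_real k (eps t) *: A) - 1 - of_real k (eps t) *: A)); last first.
  by rewrite [RHS]scalerBr [_ *: (_ *: A)]scalerA -rmorphM mulVf// rmorph1 scale1r.
apply: le_trans (mnormZ _ _) _; rewrite absK_real normfV.
rewrite mulrC ler_pdivrMr//.
have le1 : mnorm (of_real k (eps t) *: A) <= `|eps t| * a.
  by apply: le_trans (mnormZ _ _) _; rewrite absK_real.
apply: le_trans (mnorm_expm_sub1A _) _.
apply: le_trans (expR_sub1x_le (mnorm_ge0 _) (le_trans le1 small)) _.
rewrite (_ : _ * `|eps t| = 2 * (`|eps t| * a) ^+ 2); last by ring.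
by rewrite ler_pM2l// lerXn2r// ?nnegrE ?mulr_ge0 ?mnorm_ge0.
Qed.

(** Replacing h by exp (eps y) changes each of the factors by o(eps) while the
   partial products stay bounded, because their number times eps converges. *)
Lemma mcvg_power eps h y (nn : T -> nat) s :
  (\forall t \near F, 0 < eps t) -> eps t @[t --> F] --> (0 : R) ->
  mcvg F (diff_quotient eps h) y -> (nn t)%:R * eps t @[t --> F] --> s ->
  mcvg F (fun t => h t ^+ nn t) (expm (of_real k s *: y)).
Proof.
move=> e0 ec hy ns; set a := mnorm y.
pose b t := expm (of_real k (eps t) *: y).
have en0 : \forall t \near F, eps t != 0 by apply: filterS e0 => t; exact: lt0r_neq0.
have by_ : mcvg F (diff_quotient eps b) y by exact: mcvg_diff_quotient_expm.
have bs : mcvg F (fun t => b t ^+ nn t) (expm (of_real k s *: y)).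
  apply: (mcvg_near _ (mcvg_expm y ns)); apply: nearW => t.
  by rewrite /b expmMn scalerA -rmorphM.
suff hb : mcvg F (fun t => h t ^+ nn t - b t ^+ nn t) 0.
  have H : mcvg F (fun t => h t ^+ nn t - b t ^+ nn t + b t ^+ nn t)
      (0 + expm (of_real k s *: y)) by exact: mcvgD.
  rewrite add0r in H.
  by apply: (mcvg_near _ H); apply: nearW => t; rewrite subrK.
pose M t := expR (eps t * (a + 1)).
have hbd : \forall t \near F, mnorm (diff_quotient eps h t) <= a + 1.
  have hn : mnorm (diff_quotient eps h t) @[t --> F] --> mnorm y by exact: mcvg_norm.
  move/cvgrPdist_lt : hn => /(_ 1 ltr01); apply: filterS => t.
  by rewrite ltr_norml => /andP[+ _] => H; rewrite -/a in H; lra.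
pose q t := mnorm (diff_quotient eps h t - diff_quotient eps b t).
apply: (@mcvg_le _ _ _ _ _ _ _ _
    (fun t => (nn t)%:R * eps t * q t * expR ((nn t)%:R * eps t * (a + 1)))).
  apply: filterS2 e0 hbd => t e0 hbd; rewrite subr0.
  have M1 : 1 <= M t.
    by rewrite -expR0 ler_expR mulr_ge0 ?addr_ge0 ?mnorm_ge0// ltW.
  have hM : mnorm (h t) <= M t.
    apply: le_trans (expR_ge1Dx _).
    rewrite -[h t](subrK 1) addrC.
    apply: le_trans (mnormD _ _) _; apply: lerD; first exact: mnorm1.
    rewrite (_ : h t - 1 = of_real k (eps t) *: diff_quotient eps h t); last first.
      by rewrite /diff_quotient scalerA -rmorphM mulfV ?lt0r_neq0// rmorph1 scale1r.
    apply: le_trans (mnormZ _ _) _; rewrite absK_real gtr0_norm//.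
    by rewrite ler_pM2l.
  have bM : mnorm (b t) <= M t.
    apply: le_trans (mnorm_expm _) _; rewrite ler_expR.
    apply: le_trans (mnormZ _ _) _; rewrite absK_real gtr0_norm// ler_pM2l//.
    by rewrite -/a lerDl.
  apply: le_trans (mnormB_exp (nn t) M1 hM bM) _.
  rewrite -[_ * eps t * (a + 1)]mulrA expRM_natl -/(M t).
  rewrite ler_wpM2r ?exprn_ge0 ?expR_ge0// -mulrA ler_wpM2l//.
  rewrite -ler_pdivrMl//.
  have -> : q t = mnorm (of_real k (eps t)^-1 *: (h t - b t)).
    by rewrite /q /diff_quotient -scalerBr opprD opprK addrACA addNr addr0.
  have := mnormZ (of_real k (eps t)) (of_real k (eps t)^-1 *: (h t - b t)).
  rewrite scalerA -rmorphM mulfV ?lt0r_neq0// rmorph1 scale1r absK_real gtr0_norm//.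
  by rewrite ler_pdivrMl.
have q0 : q t @[t --> F] --> (0 : R).
  have H : q t @[t --> F] --> mnorm (y - y) by apply: mcvg_norm; exact: mcvgB.
  by rewrite subrr mnorm0 in H.
rewrite (_ : 0 = s * 0 * expR (s * (a + 1))); last by rewrite mulr0 mul0r.
apply: cvgM; first by apply: cvgM.
have H : (nn t)%:R * eps t * (a + 1) @[t --> F] --> s * (a + 1).
  by apply: cvgM => //; exact: cvg_cst.
exact: (cvg_comp _ _ H (@continuous_expR R _)).
Qed.

End Powers.

(** * One-parameter groups of matrices *)

Section OneParameterGroups.
Variables (R : realType) (k : scalar_kind) (n : nat).
Local Notation K := (base_field R k).
Variable U : R -> 'M[K]_n.
Hypothesis U0 : U 0 = 1.
Hypothesis UD : forall s t, U (s + t) = U s * U t.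
Hypothesis Uc : mcvg (nbhs (0 : R)) U 1.

Lemma one_parameter_cvg (T : Type) (F : set_system T) {FF : Filter F} (c : T -> R) s :
  c t @[t --> F] --> s -> mcvg F (fun t => U (c t)) (U s).
Proof.
move=> cs.
have c0 : c t - s @[t --> F] --> (0 : R).
  by rewrite -(subrr s); apply: cvgB => //; exact: cvg_cst.
have H : mcvg F (fun t => U (c t - s) * U s) (1 * U s).
  by apply: mcvgM (mcvg_cst _); exact: mcvg_comp c0 Uc.
rewrite mul1r in H; apply: (mcvg_near _ H); apply: nearW => t.
by rewrite -UD subrK.
Qed.

Lemma one_parameterX t m : U t ^+ m = U (m%:R * t).
Proof.
elim: m => [|m IH]; first by rewrite expr0 mul0r U0.
by rewrite exprSr IH -UD -natr1 mulrDl mul1r.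
Qed.

(** Let t tend to 0 from the right along an ultrafilter. If the quotients (U t - 1) / t
   are bounded, their limit A satisfies exp (s A) = lim (U t) ^ (s / t) = U s. If not, the
   normalised quotients (U t - 1) / |U t - 1| have a limit A of norm at least 1, while
   t / |U t - 1| tends to 0, and the same computation gives
   exp (s A) = U 0 = 1 for every s >= 0, which is absurd. *)
Lemma one_parameter_group :
  exists A, forall t, U t = expm (of_real k t *: A).
Proof.
have [V [VV V0]] := ultraFilterLemma (@at_right_proper_filter R 0).
have VP : ProperFilter V by exact: ultra_proper.
have idV : t @[t --> V] --> (0 : R).
  move=> B B0; apply: V0; rewrite /= in B0 *.
  exact: (cvg_at_right_filter (f := id) cvg_id).
have posV : \forall t \near V, (0 : R) < t by apply: V0; exact: nbhs_right_gt.
pose u t := mnorm (U t - 1).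
have u0 : u t @[t --> V] --> (0 : R).
  have H : mcvg V U (U 0) by exact: one_parameter_cvg idV.
  by rewrite U0 in H.
have key (eps : R -> R) A s : 0 <= s -> (\forall t \near V, 0 < eps t) ->
    eps t @[t --> V] --> (0 : R) -> mcvg V (diff_quotient eps U) A ->
    mcvg V (fun t => U ((Num.trunc (s / eps t))%:R * t)) (expm (of_real k s *: A)).
  move=> s0 ep e0 eA.
  have H : mcvg V (fun t => U t ^+ Num.trunc (s / eps t)) (expm (of_real k s *: A)).
    by apply: (mcvg_power ep e0 eA); exact: cvg_trunc_mul.
  by apply: (mcvg_near _ H); apply: nearW => t; rewrite one_parameterX.
have [[B uB]|unb] := pselect (exists B, V [set t | u t <= B * t]).
  have [A UA] : exists A, mcvg V (diff_quotient id U) A.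
    apply: (@ultra_mcvg R k n R V VV _ B).
    have {}uB : \forall t \near V, u t <= B * t by [].
    apply: filterS2 posV uB => t t0 uB /=.
    apply: le_trans (mnormZ _ _) _; rewrite absK_real normfV gtr0_norm//.
    by rewrite ler_pdivrMl// mulrC.
  have pos s : 0 <= s -> U s = expm (of_real k s *: A).
    move=> s0; apply: (@mcvg_unique R k n _ V _ _ _ _ _ (key id A s s0 posV idV UA)).
    by apply: one_parameter_cvg; exact: cvg_trunc_mul.
  exists A => t; have [/pos//|t0] := lerP 0 t.
  have e1 : expm (of_real k (- t) *: A) * expm (of_real k t *: A) = 1.
    by rewrite -expmD addNr rmorph0 scale0r expm0.
  rewrite -[LHS]mulr1 -e1 mulrA -pos; last by rewrite oppr_ge0 ltW.
  by rewrite -UD subrr U0 mul1r.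
exfalso.
have ubig B : \forall t \near V, B * t < u t.
  have [H|] := in_ultra_setVsetC [set t | u t <= B * t] VV.
    by exfalso; apply: unb; exists B.
  by apply: filterS => t /= /negP; rewrite -ltNge.
have upos : \forall t \near V, 0 < u t.
  by apply: filterS (ubig 0) => t; rewrite mul0r.
have [A UA] : exists A, mcvg V (diff_quotient u U) A.
  apply: (@ultra_mcvg R k n R V VV _ 1).
  apply: filterS upos => t t0 /=.
  apply: le_trans (mnormZ _ _) _; rewrite absK_real normfV gtr0_norm//.
  by rewrite -/(u t) mulVf// lt0r_neq0.
have tu : t / u t @[t --> V] --> (0 : R).
  apply/cvgrPdist_lt => e e0; apply: filterS3 posV upos (ubig e^-1) => t t0 p0.
  rewrite sub0r normrN ger0_norm; last by rewrite divr_ge0 ?ltW.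
  by rewrite ltr_pdivrMr// -ltr_pdivrMl.
have expA s : 0 <= s -> expm (of_real k s *: A) = 1.
  move=> s0; rewrite -U0; apply/esym.
  apply: (@mcvg_unique R k n _ V _ _ _ _ _ (key u A s s0 upos u0 UA)).
  apply: one_parameter_cvg.
  have H : (Num.trunc (s / u t))%:R * u t * (t / u t) @[t --> V] --> s * 0.
    by apply: cvgM => //; exact: cvg_trunc_mul.
  rewrite mulr0 in H; apply: cvg_trans H; apply: near_eq_cvg.
  apply: filterS upos => t t0; rewrite -mulrA; congr (_ * _).
  by rewrite mulrC divfK// lt0r_neq0.
have A1 : 1 <= mnorm A.
  rewrite -lerN2.
  have H : - mnorm (diff_quotient u U t) @[t --> V] --> - mnorm A.
    by apply: cvgN; exact: mcvg_norm.
  apply: (cvg_le_const H); apply: filterS upos => t t0; rewrite lerN2.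
  have := mnormZ (of_real k (u t)) (diff_quotient u U t).
  rewrite /diff_quotient scalerA -rmorphM mulfV ?lt0r_neq0// rmorph1 scale1r absK_real.
  by rewrite gtr0_norm// -/(u t) -ler_pdivrMl// mulVf// lt0r_neq0.
have A0 : 0 < mnorm A by apply: lt_le_trans A1.
pose s := (4 * mnorm A)^-1.
have s0 : 0 < s by rewrite invr_gt0 mulr_gt0.
have x1 : mnorm (of_real k s *: A) <= 1 / 4.
  apply: le_trans (mnormZ _ _) _; rewrite absK_real gtr0_norm// /s invfM.
  by rewrite -mulrA mulVf ?lt0r_neq0// mulr1 div1r.
have x2 := mnorm_expm_sub1A (of_real k s *: A).
have e0 : expm (of_real k s *: A) - 1 = 0.
  by apply/eqP; rewrite subr_eq0; apply/eqP; exact: expA (ltW s0).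
rewrite e0 sub0r mnormN in x2.
have q24 : (1 / 4 : R) <= 1 / 2 by lra.
have x3 := expR_sub1x_le (mnorm_ge0 (of_real k s *: A)) (le_trans x1 q24).
have x4 := mnorm_ge0 (of_real k s *: A).
have x5 : mnorm (of_real k s *: A) = 0.
  move: x1 x2 x3 x4; move: (mnorm _) => x x1 x2 x3 x4.
  have x6 : 0 <= x * (1 / 4 - x) by rewrite mulr_ge0// subr_ge0.
  rewrite mulrBr -expr2 in x6; apply/eqP; rewrite eq_le x4 andbT. lra.
have := mnorm_eq0 x5 => /eqP; rewrite scaler_eq0 of_real_eq0 (gt_eqF s0)/= => /eqP AA.
by rewrite AA mnorm0 in A1; lra.
Qed.

End OneParameterGroups.

(** * The Lie algebra of a closed linear group *)

Section Generation.
Variables (R : realType) (k : scalar_kind) (n : nat).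
Local Notation K := (base_field R k).
Implicit Types G S : set 'M[K]_n.

Lemma mulmxZl (c : K) (A B : 'M[K]_n) : (c *: A) * B = c *: (A * B).
Proof. by rewrite -[LHS]/((c *: A) *m B) -scalemxAl. Qed.

Lemma mulmxZr (c : K) (A B : 'M[K]_n) : A * (c *: B) = c *: (A * B).
Proof. by rewrite -[LHS]/(A *m (c *: B)) -scalemxAr. Qed.

Lemma expm_unit (A : 'M[K]_n) : expm A \in unitmx.
Proof.
have := expmN (1 : R) A; rewrite rmorph1 scale1r => /mulmx1_unit[].
by [].
Qed.

Lemma expm_inv (s : R) (A : 'M[K]_n) :
  invmx (expm (of_real k s *: A)) = expm (of_real k (- s) *: A).
Proof.
have u := expm_unit (of_real k s *: A).
by rewrite -[LHS]mulmx1 -[1%:M](expmN s A) -[_ * _]/(_ *m _) mulKmx.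
Qed.

Lemma linear_Lie_group_limit S (T : Type) (F : set_system T) {FF : ProperFilter F}
    (h : T -> 'M[K]_n) a : linear_Lie_group S -> a \in unitmx ->
  (\forall t \near F, S (h t)) -> mcvg F h a -> S a.
Proof.
move=> [_ _ _ _ cl] ua Sh /cvg_mcvg ha; apply: cl; split=> // B aB.
have [t [St Bt]] := filter_ex (filterI Sh (ha _ aB)).
by exists (h t).
Qed.

(** A tangent direction Y of S at 1 belongs to the Lie algebra of S: by [mcvg_power] the
   exponential of s Y is a limit of powers of elements of S, and S is closed among
   invertible matrices. *)
Lemma Lie_algebra_limit S (T : Type) (F : set_system T) {FF : ProperFilter F}
    (eps : T -> R) (h : T -> 'M[K]_n) y : linear_Lie_group S ->
  (\forall t \near F, 0 < eps t) -> eps t @[t --> F] --> (0 : R) ->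
  (\forall t \near F, S (h t)) -> mcvg F (diff_quotient eps h) y -> Lie_algebra S y.
Proof.
move=> LS e0 ec Sh hy.
have [_ S1 SM SV _] := LS.
have SX t m : S (h t) -> S (h t ^+ m).
  move=> St; elim: m => [|m IH]; first by rewrite expr0.
  by rewrite exprS; apply: SM.
have pos s : 0 <= s -> S (expm (of_real k s *: y)).
  move=> s0.
  have H : mcvg F (fun t => h t ^+ Num.trunc (s / eps t)) (expm (of_real k s *: y)).
    by apply: (mcvg_power e0 ec hy); exact: cvg_trunc_mul.
  apply: (linear_Lie_group_limit LS (expm_unit _) _ H).
  by apply: filterS Sh => t; exact: SX.
move=> t; have [/pos//|t0] := lerP 0 t.
rewrite -[t]opprK -expm_inv; apply: SV; apply: pos.
by rewrite oppr_ge0 ltW.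
Qed.

(** Sums and brackets are tangent directions of exp (t A) exp (t B) at speed t and of the
   group commutator of exp (t A) and exp (t B) at speed t^2. *)
Lemma Lie_algebra_is_subalgebra S : linear_Lie_group S ->
  Lie_subalgebra (Lie_algebra S).
Proof.
move=> LS; have [_ S1 SM SV _] := LS.
have at0 : (t : R) @[t --> (0 : R)^'+] --> (0 : R).
  exact: (cvg_at_right_filter (f := id) cvg_id).
have pos : \forall t \near (0 : R)^'+, 0 < t by exact: nbhs_right_gt.
have neq0 : \forall t \near (0 : R)^'+, t != 0.
  by apply: filterS pos => t; exact: lt0r_neq0.
have e1 A : mcvg (0 : R)^'+ (fun t : R => expm (of_real k t *: A)) 1.
  have H : mcvg (0 : R)^'+ (fun t : R => expm (of_real k t *: A)) (expm (of_real k 0 *: A)).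
    exact: mcvg_expm.
  by rewrite rmorph0 scale0r expm0 in H.
have d1 A : mcvg (0 : R)^'+ (diff_quotient id (fun t : R => expm (of_real k t *: A))) A.
  exact: mcvg_diff_quotient_expm.
split.
- by move=> t; rewrite scaler0 expm0.
- move=> A B SA SB.
  apply: (@Lie_algebra_limit S R (0 : R)^'+ _ id
    (fun t => expm (of_real k t *: A) * expm (of_real k t *: B))) => //.
    by apply: nearW => t; apply: SM; [exact: SA|exact: SB].
  have H : mcvg (0 : R)^'+ (fun t =>
      diff_quotient id (fun t : R => expm (of_real k t *: A)) t * expm (of_real k t *: B)
      + diff_quotient id (fun t : R => expm (of_real k t *: B)) t) (A * 1 + B).
    by apply: mcvgD => //; apply: mcvgM.
  rewrite mulr1 in H; apply: (mcvg_near _ H); apply: nearW => t.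
  rewrite /diff_quotient -[_ * _]/(_ *m _) -scalemxAl -scalerDr; congr (_ *: _).
  by rewrite -[_ *m _]/(_ * _) mulrBl mul1r addrA subrK.
- by move=> t A SA s; rewrite scalerA -rmorphM; exact: SA.
- move=> A B SA SB.
  apply: (@Lie_algebra_limit S R (0 : R)^'+ _ (fun t => t ^+ 2)
    (fun t => expm (of_real k t *: A) * expm (of_real k t *: B) *
      expm (of_real k (- t) *: A) * expm (of_real k (- t) *: B))) => //.
  + by apply: filterS pos => t t0; rewrite exprn_gt0.
  + by rewrite -[X in _ --> X](mulr0 0); apply: cvgM.
  + apply: nearW => t.
    exact: SM _ _ (SM _ _ (SM _ _ (SA _) (SB _)) (SA _)) (SB _).
  have at0N : - (t : R) @[t --> (0 : R)^'+] --> (0 : R).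
    by rewrite -[X in _ --> X]oppr0; apply: cvgN.
  have e1N C : mcvg (0 : R)^'+ (fun t : R => expm (of_real k (- t) *: C)) 1.
    have H : mcvg (0 : R)^'+ (fun t : R => expm (of_real k (- t) *: C))
        (expm (of_real k 0 *: C)) by exact: mcvg_expm.
    by rewrite rmorph0 scale0r expm0 in H.
  pose dA := diff_quotient id (fun t : R => expm (of_real k t *: A)).
  pose dB := diff_quotient id (fun t : R => expm (of_real k t *: B)).
  have H : mcvg (0 : R)^'+ (fun t => (dA t * dB t - dB t * dA t) *
     expm (of_real k (- t) *: A) * expm (of_real k (- t) *: B))
     ((A * B - B * A) * 1 * 1).
    apply: mcvgM => //; apply: mcvgM => //.
    by apply: mcvgB; apply: mcvgM; exact: d1.
  rewrite !mulr1 in H; apply: (mcvg_near _ H); apply: nearW => t.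
  rewrite /dA /dB /diff_quotient.
  have eA := expmN t A; have eB := expmN t B.
  move: (expm (of_real k t *: A)) (expm (of_real k t *: B))
    (expm (of_real k (- t) *: A)) (expm (of_real k (- t) *: B)) eA eB
    => a b a' b' eA eB.
  (* the commutator of a and b equals that of a - 1 and b - 1, both of order t *)
  have -> : a * b * a' * b' - 1 = ((a - 1) * (b - 1) - (b - 1) * (a - 1)) * a' * b'.
    have -> : (a - 1) * (b - 1) - (b - 1) * (a - 1) = a * b - b * a.
      rewrite !mulrBl !mulrBr !mulr1 !mul1r !opprB.
      rewrite (_ : a * b - a + (1 - b) = a * b - (a - 1 + b)); last first.
        by rewrite !opprD opprK !addrA.
      by rewrite [a - 1 + (b - _)]addrA subrKA.
    rewrite !mulrBl -[b * a * a']mulrA eA mulr1 eB.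
    by [].
  rewrite !mulmxZl !mulmxZr !scalerA -scalerBr !mulmxZl.
  by rewrite -rmorphM -exprVn expr2.
Qed.


End Generation.

(** * Generation of a connected group by one-parameter groups *)

Section Connectedness.
Variables (R : realType) (k : scalar_kind) (n : nat).
Local Notation K := (base_field R k).
Implicit Types G S : set 'M[K]_n.

(** The infimum of |x y - 1| over x in S is positive because S is closed and y^-1
   is not in S, so it is approached within a factor 2. *)
Lemma near_minimizer S (y : 'M[K]_n) : linear_Lie_group S -> y \in unitmx -> ~ S y ->
  exists x, [/\ S x, 0 < mnorm (x * y - 1) &
    forall x', S x' -> mnorm (x * y - 1) <= 2 * mnorm (x' * y - 1)].
Proof.
move=> LS uy nSy; have [_ S1 SM SV cl] := LS.
pose E := [set mnorm (x * y - 1) | x in S].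
have E0 : E !=set0 by exists (mnorm (1 * y - 1)), 1.
have lbE : lbound E 0 by move=> _ [x _ <-]; exact: mnorm_ge0.
have hE : has_inf E by split=> //; exists 0.
have d0 : 0 < inf E.
  rewrite lt_neqAle lb_le_inf// andbT; apply/eqP => d0.
  apply: nSy; rewrite -[y]invmxK; apply: SV; apply: cl; split; last first.
    by rewrite /= unitmx_inv.
  move=> B /nbhs_mnorm[e e0 HB].
  set a := mnorm (invmx y) + 1.
  have a0 : 0 < a by rewrite ltr_wpDl ?mnorm_ge0.
  have [_ [x Sx <-]] := inf_adherent (divr_gt0 e0 a0) hE.
  rewrite -d0 add0r ltr_pdivlMr// => xe.
  exists x; split=> //; apply: HB; apply: le_lt_trans xe.
  rewrite (_ : x - _ = (x * y - 1) * invmx y); last first.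
    by rewrite mulrBl mul1r -!mulmxE mulmxK.
  apply: le_trans (mnormM _ _) _; rewrite ler_wpM2l ?mnorm_ge0//.
  by rewrite lerDl.
have [_ [x Sx <-]] := inf_adherent d0 hE.
move=> xd.
have lb x' : S x' -> inf E <= mnorm (x' * y - 1).
  by move=> Sx'; apply: ge_inf; [exists 0|exists x'].
exists x; split=> //; first by apply: lt_le_trans d0 (lb _ Sx).
by move=> x' Sx'; have := lb _ Sx'; lra.
Qed.

(** If elements g of G outside S accumulated at 1, multiply each by a nearly optimal
   x in S and let Y be a limit of the unit vectors (x g - 1) / |x g - 1|. Then Y
   lies in the Lie algebra of G, hence of S, and exp (- |x g - 1| Y) x contradicts
   the near optimality of x. *)
Lemma Lie_subgroup_near1 G S : linear_Lie_group G -> linear_Lie_group S ->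
  Lie_algebra G `<=` Lie_algebra S ->
  (forall g, S g -> G g) -> nbhs (1 : 'M[K]_n) [set g | G g -> S g].
Proof.
move=> LG LS GS SG; apply: contrapT => nn.
have [Gu _ GM _ _] := LG; have [_ S1 SM SV _] := LS.
pose D := [set g | G g /\ ~ S g].
have PF : ProperFilter (within D (nbhs (1 : 'M[K]_n))).
  apply: Build_ProperFilter_ex => B /= HB.
  apply: contrapT => B0; apply: nn; rewrite /within/= in HB.
  apply: filterS HB => g HB Gg; apply: contrapT => Sg.
  by apply: B0; exists g; apply: HB.
have [U [UU FU]] := ultraFilterLemma PF.
have PU : ProperFilter U by exact: ultra_proper.
have UD : \forall g \near U, D g by apply: FU; exact: withinT.
have Uid : mcvg U id 1.
  apply/cvg_mcvg => B B1; apply: FU; exact: cvg_within B1.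
have /choice[x xP] (y : 'M[K]_n) : exists x, D y -> [/\ S x, 0 < mnorm (x * y - 1) &
    forall x', S x' -> mnorm (x * y - 1) <= 2 * mnorm (x' * y - 1)].
  have [[Gy nSy]|nD] := pselect (D y); last by exists 1.
  by have [x] := near_minimizer LS (Gu _ Gy) nSy; exists x.
pose h y := x y * y; pose eps y := mnorm (h y - 1).
have eps_gt0 : \forall y \near U, 0 < eps y.
  by apply: filterS UD => y /xP[].
have eps0 : eps y @[y --> U] --> (0 : R).
  have H : 2 * mnorm (y - 1) @[y --> U] --> (2 * 0 : R).
    by apply: cvgM; [exact: cvg_cst|exact: Uid].
  rewrite mulr0 in H; apply: cvg0_le H.
  apply: filterS UD => y /xP[_ _ /(_ 1 S1)]; rewrite mul1r => ->.
  by rewrite mnorm_ge0.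
have hc : mcvg U h 1 by exact: eps0.
have [Y hY] : exists Y, mcvg U (diff_quotient eps h) Y.
  apply: (@ultra_mcvg R k n _ U UU _ 1).
  apply: filterS eps_gt0 => y e0 /=.
  apply: le_trans (mnormZ _ _) _; rewrite absK_real normfV gtr0_norm//.
  by rewrite -/(eps y) mulVf// lt0r_neq0.
have SY : Lie_algebra S Y.
  apply: GS; apply: (Lie_algebra_limit LG eps_gt0 eps0 _ hY).
  by apply: filterS UD => y [/[dup] Dy Gy nSy]; apply: GM => //; have [/SG] := xP y (conj Gy nSy).
pose b y := expm (of_real k (eps y) *: - Y).
have bq : mcvg U (diff_quotient eps b) (- Y).
  apply: mcvg_diff_quotient_expm => //.
  by apply: filterS eps_gt0 => y; exact: lt0r_neq0.
have bh : mcvg U (fun y => diff_quotient eps b y * h y + diff_quotient eps h y) (- Y * 1 + Y).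
  by apply: mcvgD => //; apply: mcvgM.
rewrite mulr1 addNr in bh.
have bh0 : mnorm (diff_quotient eps b y * h y + diff_quotient eps h y) @[y --> U] --> (0 : R).
  by have H := mcvg_norm bh; rewrite mnorm0 in H; apply: H.
suff : (1 / 2 : R) <= 0 by lra.
rewrite -lerN2.
have H : - mnorm (diff_quotient eps b y * h y + diff_quotient eps h y) @[y --> U] --> (- 0 : R).
  by apply: cvgN.
apply: (cvg_le_const H).
apply: filterS2 UD eps_gt0 => y Dy e0; rewrite lerN2.
have [Sx _ /(_ (b y * x y))] := xP y Dy.
have Sb : S (b y) by rewrite /b scalerN -scaleNr -rmorphN; exact: SY.
move=> /(_ (SM _ _ Sb Sx)); rewrite -/(h y) -/(eps y) -mulrA -/(h y) => le1.
have e2 : b y * h y - 1 = of_real k (eps y) *: (diff_quotient eps b y * h y + diff_quotient eps h y).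
  rewrite /diff_quotient mulmxZl -scalerDr scalerA -rmorphM mulfV ?lt0r_neq0// rmorph1 scale1r.
  by rewrite mulrBl mul1r subrKA.
rewrite e2 in le1.
have le2 := mnormZ (of_real k (eps y)) (diff_quotient eps b y * h y + diff_quotient eps h y).
rewrite absK_real gtr0_norm// in le2.
set z := mnorm (diff_quotient eps b y * h y + diff_quotient eps h y) in le1 le2 *.
have {le1 le2} : eps y * 1 <= eps y * (2 * z) by nra.
by rewrite ler_pM2l//; lra.
Qed.

(** The Lie algebra of S contains the generators X_d, hence equals that of G, so that S
   is open in G near 1 and, by translation, everywhere. *)
Lemma Lie_generators_closed_subgroup G S (Ndim : nat) (X : 'I_Ndim -> 'M[K]_n) :
  linear_Lie_group G -> connected G -> Lie_generators G X ->
  linear_Lie_group S -> S `<=` G ->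
  (forall d (t : R), S (expm (of_real k t *: X d))) -> S = G.
Proof.
move=> LG Gconn [_ genX] LS SG SX.
have [Gu G1 GM GV _] := LG; have [_ S1 SM SV clS] := LS.
have GS : Lie_algebra G `<=` Lie_algebra S.
  by apply: genX; [exact: Lie_algebra_is_subalgebra|].
have near1 := Lie_subgroup_near1 LG LS GS SG.
apply: Gconn; first by exists 1%:M.
  exists (interior [set g | G g -> S g]); first exact: open_interior.
  apply/seteqP; split=> [x Sx|x [Gx /nbhs_singleton]]; last exact.
  split; first exact: SG.
  have /nbhs_mnorm[e e0 He] := near1; apply/nbhs_mnorm.
  set a := mnorm (invmx x) + 1.
  have a0 : 0 < a by rewrite ltr_wpDl ?mnorm_ge0.
  exists (e / a); first exact: divr_gt0.
  move=> y ye Gy; have ux := Gu _ (SG _ Sx).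
  rewrite -[y](mulKVmx ux); apply: (SM _ _ Sx); apply: He; last first.
    by apply: GM Gy; apply: GV; exact: SG.
  rewrite (_ : _ - 1 = invmx x * (y - x)); last first.
    by rewrite mulrBr -!mulmxE mulVmx.
  apply: le_lt_trans (mnormM _ _) _.
  rewrite ltr_pdivlMr// mulrC in ye; apply: le_lt_trans ye.
  by rewrite ler_wpM2r ?mnorm_ge0// lerDl.
exists (closure S); first exact: closed_closure.
apply/seteqP; split=> [x Sx|x [Gx cx]].
  by split; [exact: SG|exact: subset_closure].
by apply: clS; split=> //; exact: Gu.
Qed.

End Connectedness.

(** * The multilinear coefficient of a form *)

Section Content.
Variable N : nat.
Implicit Types t s : {ffun 'I_N -> 'I_N}.

(** The multiplicities with which the indices occur in t, seen as a point of the simplex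
   |x| = N. *)
Definition content t (a : 'I_N) : nat := \sum_(i < N) (t i == a).

Definition occurrences_before t (a : 'I_N) (j : nat) : nat :=
  \sum_(i < N | (i < j)%N) (t i == a).

Lemma sum_content t : (\sum_a content t a = N)%N.
Proof.
rewrite /content exchange_big/= -[RHS]card_ord -sum1_card; apply: eq_bigr => i _.
by rewrite (bigD1 (t i))//= eqxx big1// => a; rewrite eq_sym => /negPf->.
Qed.

Lemma occurrences_beforeS t a (i : 'I_N) :
  occurrences_before t a i.+1 = (occurrences_before t a i + (t i == a))%N.
Proof.
rewrite /occurrences_before (bigD1 i)//= addnC; congr (_ + _)%N.
by apply: eq_bigl => j; rewrite ltnS ltn_neqAle andbC.
Qed.

Lemma occurrences_before_lt t i : (occurrences_before t (t i) i < content t (t i))%N.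
Proof.
rewrite /content (bigD1 i)//= eqxx add1n ltnS /occurrences_before.
rewrite [leqRHS]big_mkcond [leqLHS]big_mkcond/=; apply: leq_sum => j _.
by case: (eqVneq j i) => [->|_]; rewrite ?ltnn//=; case: ifP.
Qed.

(** The number of earlier occurrences of a starts at 0 and grows by 1 at each occurrence
   of a, hence takes every value below the total number. *)
Lemma occurrence_number t a c : (c < content t a)%N ->
  exists2 i, t i = a & occurrences_before t a i = c.
Proof.
move=> cta.
have ex : exists j, (c < occurrences_before t a j)%N.
  exists N; rewrite /occurrences_before (_ : \sum_(i < N | _) _ = content t a)//.
  by apply: eq_bigl => i; rewrite ltn_ord.
case: (ex_minnP ex) => j cj jmin.
have jN : (j <= N)%N.
  apply: jmin; rewrite /occurrences_before (_ : \sum_(i < N | _) _ = content t a)//.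
  by apply: eq_bigl => i; rewrite ltn_ord.
case: j cj jmin jN => [|j] cj jmin jN.
  by move: cj; rewrite /occurrences_before big_pred0.
have cj' : (occurrences_before t a j <= c)%N.
  by rewrite leqNgt; apply/negP => /jmin; rewrite ltnn.
move: cj; rewrite (occurrences_beforeS t a (Ordinal jN))/=.
exists (Ordinal jN) => /=; last first.
  by apply/eqP; rewrite eqn_leq cj'/= -ltnS (leq_trans cj)// -addn1 leq_add2l leq_b1.
by apply/eqP; case: eqP cj => //= _; rewrite addn0 ltnNge cj'.
Qed.

Lemma content_lt t t' : content t <> content t' -> exists a, (content t' a < content t a)%N.
Proof.
move=> tt'; apply: contrapT => H; apply: tt'.
have le a : (content t a <= content t' a)%N.
  by rewrite leqNgt; apply/negP => lt; apply: H; exists a.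
have := @leqif_sum _ predT (fun a => content t a == content t' a)
  (content t) (content t') (fun a _ => leqif_eq (le a)).
move=> [_]; rewrite !sum_content eqxx => /esym/forallP/= H'.
by apply/funext => a; exact/eqP.
Qed.

End Content.

(** The values of a form of degree N in N variables at the points of the simplex
   {x in nat^N : |x| = N} determine its coefficients: the Lagrange polynomial of the
   point content t is prod_i (x_(t i) - c_i |x| / N), where c_i is the
   number of occurrences of t i before position i. In matrix terms, the matrix of monomials A and
   the matrix E of the relation of having equal content have the same row space, and
   the coefficient of x_1 ... x_N is a row of E. *)
Lemma multilinear_coefficient (K : numFieldType) (N : nat) :
  exists kappa : {ffun 'I_N -> 'I_N} -> K, forall s : {ffun 'I_N -> 'I_N},
    \sum_t kappa t * \prod_i (content t (s i))%:R = (injectiveb s)%:R.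
Proof.
pose T := {ffun 'I_N -> 'I_N}.
pose a (t s : T) : K := \prod_i (content t (s i))%:R.
pose same (t s : T) := `[< content t = content s >].
have aE t s : a t s = \prod_(b : 'I_N) (content t b)%:R ^+ content s b.
  rewrite /a; under [RHS]eq_bigr do rewrite {2}/content expr_sum.
  rewrite exchange_big/=; apply: eq_bigr => i _.
  by rewrite (bigD1 (s i))//= eqxx expr1 big1 ?mulr1// => b; rewrite eq_sym => /negPf->.
pose A : 'M[K]_#|T| := \matrix_(i, j) a (enum_val i) (enum_val j).
pose E : 'M[K]_#|T| := \matrix_(i, j) (same (enum_val i) (enum_val j))%:R.
pose cl (s : T) : K := \sum_(s' : T) (same s' s)%:R.
have clN0 s : cl s != 0.
  rewrite /cl (bigD1 s)//= /same asboolT//.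
  by rewrite gt_eqF// ltr_wpDr ?ltr01//; apply: sumr_ge0 => i _; exact: ler0n.
(* A depends on its column only through the content, so averaging over the columns of
   equal content does not change it *)
have AE : (A <= E)%MS.
  apply/submxP; exists (\matrix_(i, j) (a (enum_val i) (enum_val j) / cl (enum_val j))).
  apply/matrixP => i j; rewrite !mxE.
  rewrite (eq_bigr (fun x => (fun s => a (enum_val i) (enum_val j) / cl (enum_val j) *
    (same s (enum_val j))%:R) (enum_val x))); last first.
    move=> x _; rewrite !mxE /same; case: asboolP => [H|_]; last by rewrite !mulr0.
    rewrite !mulr1 !aE H; congr (_ / _).
    by rewrite /cl /same H.
  rewrite -(big_enum_val (fun s => a (enum_val i) (enum_val j) / cl (enum_val j) *
    (same s (enum_val j))%:R)) /= -mulr_sumr.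
  by rewrite -/(cl _) divfK.
(* B lists the coefficients of the Lagrange polynomials, which vanish at the contents
   different from that of t because some factor does *)
pose w (t : T) i b : K := (b == t i)%:R - (occurrences_before t (t i) i)%:R / N%:R.
pose B (t s : T) : K := \prod_i w t i (s i).
have BA t t' : \sum_s B t s * a t' s =
    \prod_i ((content t' (t i))%:R - (occurrences_before t (t i) i)%:R).
  rewrite (eq_bigr (fun s : T => \prod_i (w t i (s i) * (content t' (s i))%:R))); last first.
    by move=> s _; rewrite big_split.
  rewrite -(bigA_distr_bigA (fun i b => w t i b * (content t' b)%:R)).
  apply: eq_bigr => i _; rewrite /w.
  under eq_bigr do rewrite mulrBl.
  rewrite sumrB; congr (_ - _).
    by rewrite (bigD1 (t i))//= eqxx mul1r big1 ?addr0// => b /negPf->; rewrite mul0r.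
  rewrite -mulr_sumr -natr_sum sum_content divfK//.
  by rewrite pnatr_eq0 -lt0n (leq_ltn_trans _ (ltn_ord i)).
pose D (t : T) : K := \sum_s B t s * a t s.
have DN0 t : D t != 0.
  rewrite /D BA prodf_seq_neq0; apply/allP => i _ /=.
  by rewrite subr_eq0 eqr_nat gtn_eqF// occurrences_before_lt.
have ErA : (\rank E <= \rank A)%N.
  rewrite -(mxrank_tr A).
  have -> : E = (\matrix_(i, j) (B (enum_val i) (enum_val j) / D (enum_val i))) *m A^T.
    apply/matrixP => i j; rewrite !mxE.
    rewrite (eq_bigr (fun x => (fun s => (D (enum_val i))^-1 *
      (B (enum_val i) s * a (enum_val j) s)) (enum_val x))); last first.
      by move=> x _; rewrite !mxE; ring.
    rewrite -(big_enum_val (fun s => (D (enum_val i))^-1 *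
      (B (enum_val i) s * a (enum_val j) s))) /= -mulr_sumr.
    rewrite /same; case: asboolP => [H|H].
      rewrite (_ : \sum_(s : T) _ = D (enum_val i)) ?mulVf//.
      by apply: eq_bigr => s _; rewrite !aE H.
    rewrite BA; have [b bP] := content_lt H.
    have [x tx ox] := occurrence_number bP.
    by rewrite (bigD1 x)//= tx ox subrr mul0r mulr0.
  exact: mxrankS (submxMl _ _).
have EA : (E <= A)%MS.
  have := mxrank_leqif_eq AE => -[_]; rewrite eqn_leq ErA (mxrankS AE).
  by move=> /esym/andP[].
have [C EC] := submxP EA.
(* the content of the identity is (1, ..., 1), shared by the injective maps only *)
pose one : T := [ffun i => i].
exists (fun t => C (enum_rank one) (enum_rank t)) => s.
have := congr1 (fun M : 'M[K]_#|T| => M (enum_rank one) (enum_rank s)) EC.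
rewrite !mxE !enum_rankK => H.
have <- : (same one s)%:R = (injectiveb s)%:R :> K.
  have c1 b : content one b = 1%N.
    by rewrite /content (bigD1 b)//= ffunE eqxx big1// => i; rewrite ffunE => /negPf->.
  congr (_%:R); congr nat_of_bool; rewrite /same; apply/asboolP/injectiveP => [c1s i j ij|sinj].
    apply/eqP; apply: contraT => neij.
    have := c1 (s i); rewrite c1s /content (bigD1 i)//= (bigD1 j)/=; last by rewrite eq_sym.
    by rewrite -ij eqxx.
  apply/funext => b; rewrite c1 /content.
  have [g sg gs] := injF_bij sinj.
  rewrite (bigD1 (g b))//= gs eqxx big1// => i.
  by case: (eqVneq (s i) b) => // <-; rewrite sg eqxx.
rewrite H.
rewrite (eq_bigr (fun x => (fun t => C (enum_rank one) (enum_rank t) * a t s) (enum_val x))).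
  by rewrite -(big_enum_val (fun t => C (enum_rank one) (enum_rank t) * a t s)).
by move=> x _; rewrite !mxE enum_rankK enum_valK.
Qed.

(** * Linear independence of the symmetric products *)

Section ScalarProducts.
Variables (R : realType) (k : scalar_kind).
Local Notation K := (base_field R k).

Lemma scalar_product_suml (E : lmodType K) (V : set E) (ip : E -> E -> K)
    (I : Type) (r : seq I) (a : I -> K) (u : I -> E) (w : E) :
  scalar_product V ip -> (forall i, V (u i)) -> V w ->
  V (\sum_(i <- r) a i *: u i) /\
  ip (\sum_(i <- r) a i *: u i) w = \sum_(i <- r) a i * ip (u i) w.
Proof.
move=> [[V0 VD] [ipD _ _ _]] Vu Vw.
elim: r => [|i r [IHV IH]]; rewrite ?big_nil ?big_cons.
  split=> //; have := ipD 1 0 0 w V0 V0 Vw.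
  rewrite scaler0 addr0 mul1r => /eqP.
  by rewrite -subr_eq0 opprD addrA subrr sub0r oppr_eq0 => /eqP.
by split; [exact: VD|rewrite ipD// IH].
Qed.

End ScalarProducts.

Section LinearIndependence.
Context {R : realType} {k : scalar_kind}.
Local Notation K := (base_field R k).
Context {Omega : Type} {F : comAlgType K}.
Context {dL dM : Order.disp_t} {calL : orderType dL}.
Context {M : calL -> finOrderType dM}.
Variables (phi : forall l : calL, M l -> Omega -> F).
Context {N : nat}.
Variable l : 'I_N -> calL.
Implicit Types r : 'I_N -> Omega.

Lemma phibar_repetition (t : {ffun 'I_N -> 'I_N}) (m : multi_index M l) r :
  phibar phi m (fun a => r (t a)) =
  \sum_(s : {ffun 'I_N -> 'I_N}) (\prod_i (content t (s i))%:R) *: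
    \prod_i phi (m i) (r (s i)).
Proof.
rewrite /phibar.
transitivity (\prod_i \sum_b ((content t b)%:R : K) *: phi (m i) (r b)).
  apply: eq_bigr => i _; rewrite /content.
  under [RHS]eq_bigr do rewrite natr_sum scaler_suml.
  rewrite exchange_big/=; apply: eq_bigr => a _.
  rewrite (bigD1 (t a))//= eqxx scale1r big1 ?addr0// => b.
  by rewrite eq_sym => /negPf->; rewrite scale0r.
rewrite bigA_distr_bigA; apply: eq_bigr => s _.
by rewrite scaler_prod.
Qed.

(** Combining the values of phibar at tuples with repeated points leaves the terms in
   which the N factors are evaluated at N distinct positions. *)
Lemma phibar_polarization :
  exists kappa : {ffun 'I_N -> 'I_N} -> K, forall (m : multi_index M l) r,
    \sum_t kappa t *: phibar phi m (fun a => r (t a)) =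
    \sum_(s : {perm 'I_N}) tensor (fun i => phi (m (s i))) r.
Proof.
have [kappa kP] := multilinear_coefficient K N.
exists kappa => m r.
transitivity (\sum_(s : {ffun 'I_N -> 'I_N} | injectiveb s) \prod_i phi (m i) (r (s i))).
  under eq_bigr do rewrite phibar_repetition scaler_sumr.
  rewrite exchange_big [RHS]big_mkcond/=; apply: eq_bigr => s _.
  under eq_bigr do rewrite scalerA.
  rewrite -scaler_suml kP.
  by case: (injectiveb s); rewrite ?scale1r ?scale0r.
pose f (s : {perm 'I_N}) : {ffun 'I_N -> 'I_N} := val (s^-1)%g.
have fE s i : f s i = (s^-1)%g i by rewrite pvalE.
rewrite (reindex f); last first.
  exists (fun s : {ffun 'I_N -> 'I_N} => (insubd (1%g : {perm 'I_N}) s)^-1)%g => s; rewrite inE => fs.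
    by apply: invg_inj; rewrite invgK; exact: valKd.
  by rewrite /f invgK insubdK.
apply: eq_big => [s|s _].
  by apply/injectiveP => i j; rewrite !fE => /perm_inj.
rewrite /tensor (reindex_inj (@perm_inj _ s))/=; apply: eq_bigr => i _.
by rewrite fE permK.
Qed.

(** After polarization only tensor products remain. The scalar product with the tensor
   product of a class b counts the permutations matching a representative with that of
   b: there is none for the other classes, and the identity is one for b. *)
Lemma phibar_class_free (H : set (Omega -> F)) (ip : (Omega -> F) -> (Omega -> F) -> K)
    (HN : set (('I_N -> Omega) -> F))
    (ipN : (('I_N -> Omega) -> F) -> (('I_N -> Omega) -> F) -> K)
    (c : multi_class M l -> K) :
  (forall (l : calL) (m : M l), H (phi m)) -> orthonormal_family phi ip ->
  tensor_scalar_product H ip HN ipN ->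
  \sum_a c a *: phibar_class phi a = 0 -> forall a, c a = 0.
Proof.
move=> hH horth [hN htens] c0 b.
have [kappa kP] := phibar_polarization.
have sym0 : \sum_(m : multi_class M l) \sum_(s : {perm 'I_N})
    c m *: (tensor (fun i => phi (repr m (s i))) : ('I_N -> Omega) -> F) = 0.
  apply/funext => r.
  have : \sum_(t : {ffun 'I_N -> 'I_N}) kappa t *:
      (\sum_a c a *: phibar_class phi a : ('I_N -> Omega) -> F) (fun a => r (t a)) = 0.
    by rewrite c0; apply: big1 => t _; rewrite scaler0.
  move=> e0; rewrite -[RHS]/(0 : F) -[RHS]e0 fct_sumE.
  under [RHS]eq_bigr do rewrite fct_sumE scaler_sumr.
  rewrite [RHS]exchange_big/=; apply: eq_bigr => m _.
  rewrite fct_sumE -scaler_sumr -kP scaler_sumr.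
  by apply: eq_bigr => t _; rewrite !scalerA mulrC.
pose T (m : multi_class M l) (s : {perm 'I_N}) : ('I_N -> Omega) -> F :=
  tensor (fun i => phi (repr m (s i))).
pose w : ('I_N -> Omega) -> F := tensor (fun i => phi (repr b i)).
have HT m s : HN (T m s).
  by have [] := htens _ _ (fun i => hH _ (repr m (s i))) (fun i => hH _ (repr b i)).
have Hw : HN w by have [] := htens _ _ (fun i => hH _ (repr b i)) (fun i => hH _ (repr b i)).
have ipT m s : ipN (T m s) w = [forall i, label (repr m) (s i) == label (repr b) i]%:R.
  have [_ _ ->] := htens _ _ (fun i => hH _ (repr m (s i))) (fun i => hH _ (repr b i)).
  have E i : ip (phi (repr m (s i))) (phi (repr b i)) =
      (label (repr m) (s i) == label (repr b) i)%:R.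
    exact: (horth (label (repr m) (s i)) (label (repr b) i)).
  under eq_bigr do rewrite E.
  have [/forallP H1|] := boolP [forall i, label (repr m) (s i) == label (repr b) i].
    by rewrite big1// => i _; rewrite H1.
  by rewrite negb_forall => /existsP[i /negPf H1]; rewrite (bigD1 i)//= H1 mul0r.
have ip0 : ipN 0 w = 0.
  by have [_] := scalar_product_suml ([::] : seq unit) (fun=> 0) hN (fun=> Hw) Hw; rewrite !big_nil.
have sum0 : \sum_(m : multi_class M l) c m *
    \sum_(s : {perm 'I_N}) [forall i, label (repr m) (s i) == label (repr b) i]%:R = 0.
  move: ip0; rewrite -sym0 pair_big/=.
  have [_ ->] := scalar_product_suml (index_enum _)
    (fun p : (multi_class M l * {perm 'I_N})%type => c p.1)
    hN (fun p => HT p.1 p.2) Hw.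
  move=> ip0; rewrite -[RHS]ip0 -(pair_big xpredT xpredT (fun m s => c m * ipN (T m s) w))/=.
  by apply: eq_bigr => m _; rewrite mulr_sumr; apply: eq_bigr => s _; rewrite ipT.
move: sum0; rewrite (bigD1 b)//= [X in _ + X]big1 ?addr0; last first.
  move=> m mb; rewrite big1 ?mulr0// => s _.
  have [/forallP H1|//] := boolP [forall i, label (repr m) (s i) == label (repr b) i].
  case/eqP: mb; apply/eqP; rewrite -[m]reprK -[b]reprK; apply/eqP/eqquotP.
  apply/existsP; exists s; apply/andP; split; apply/forallP => i.
    by have /eqP/(congr1 tag)/= -> := H1 i.
  by rewrite eq_sym.
move=> /eqP; rewrite mulf_eq0 => /orP[/eqP//|].
rewrite (bigD1 (1%g : {perm 'I_N}))//=.
rewrite (_ : [forall i, _] = true); last first.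
  by apply/forallP => i; rewrite perm1.
rewrite gt_eqF// ltr_wpDr ?ltr01//; apply: sumr_ge0 => s _; exact: ler0n.
Qed.

End LinearIndependence.

(** * One-index changes of a multi-index *)

Lemma bigA_distr_dffun (K : comNzRingType) (I : finType) (T : I -> finType)
    (f : forall i, T i -> K) :
  \prod_i \sum_(p : T i) f i p = \sum_(m : {dffun forall i, T i}) \prod_i f i (m i).
Proof.
transitivity (\sum_(t : fprod T) \prod_(i in I) [ffun p => f i p] (t i)).
  rewrite big_fprod -(bigA_distr_big_dep (fun i => tagged_with T i)
    (fun i g => untag 0 [ffun p => f i p] g)).
  apply: eq_bigr => i _.
  transitivity (\sum_(x : {g in tagged_with T i}) f i (untag_with i x)).
    by apply: reindex; exact/onW_bij/untag_with_bij.
  apply/esym; transitivity (\sum_(x : {g in tagged_with T i})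
      untag 0 [ffun p => f i p] (val x)); first exact: big_sub.
  by apply: eq_bigr => g _; rewrite (untagE _ _ (eqP (valP g))) ffunE.
rewrite (reindex (@fprod_of_dffun _ T)); last exact/onW_bij/fprod_of_dffun_bij.
by apply: eq_bigr => m _; apply: eq_bigr => i _; rewrite ffunE fprodE.
Qed.

Section LabelCounts.
Context {dL dM : Order.disp_t} {calL : orderType dL}.
Context {M : calL -> finOrderType dM} {N : nat}.
Variable l : 'I_N -> calL.
Implicit Types m : multi_index M l.

(** The count vectors of all blocks at once: comparing labels in the disjoint union
   avoids transporting indices between the types M (l i) and M (block_val j). *)
Definition label_count m (x : {x : calL & M x}) : nat := \sum_i (label m i == x).

Lemma lambda_label_count m (j : 'I_(Nblocks l)) (p : M (block_val j)) :
  lambda m p = label_count m (Tagged M p).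
Proof.
rewrite /lambda /block count_map count_filter -sum1_count /label_count.
rewrite big_enum_cond/= big_mkcond/=; apply: eq_bigr => i _.
case: (eqVneq (label m i) _) => [e|//].
by rewrite -[l i]/(tag (label m i)) e eqxx.
Qed.

Lemma block_of_position (i : 'I_N) : exists j : 'I_(Nblocks l), block_val j = l i.
Proof.
have li : l i \in block_values l by rewrite mem_undup; apply/codomP; exists i.
have lt : (index (l i) (block_values l) < Nblocks l)%N by rewrite index_mem.
by exists (Ordinal lt); rewrite /block_val (tnth_nth (l i))/= nth_index.
Qed.

Lemma block_label (i : 'I_N) (u : M (l i)) :
  exists (j : 'I_(Nblocks l)) (p : M (block_val j)), Tagged M p = Tagged M u.
Proof.
have [j e] := block_of_position i; exists j.
by move: u; rewrite -e => u; exists u.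
Qed.

Lemma label_count_block x :
  (exists (j : 'I_(Nblocks l)) (p : M (block_val j)), Tagged M p = x) \/
  ~ (exists (j : 'I_(Nblocks l)) (p : M (block_val j)), Tagged M p = x) /\
  forall m, label_count m x = 0%N.
Proof.
have [?|nb] := pselect (exists (j : 'I_(Nblocks l)) (p : M (block_val j)), Tagged M p = x).
  by left.
right; split=> // m; rewrite /label_count big1// => i _.
by case: eqP => // ix; case: nb; rewrite -ix; exact: block_label.
Qed.

Lemma label_count_perm m m' :
  (forall x, label_count m' x = label_count m x) -> same_class m m'.
Proof.
move=> H.
have : perm_eq [tuple label m' i | i < N] [tuple label m i | i < N].
  have cE (m0 : multi_index M l) x :
      count_mem x [tuple label m0 i | i < N] = label_count m0 x.
    rewrite /= count_map -sum1_count big_enum_cond /label_count/=.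
    by rewrite [LHS]big_mkcond.
  by apply/allP => x _ /=; rewrite !cE H.
case/tuple_permP => s sP; apply/existsP; exists s.
have sE i : label m' i = label m (s i).
  by have /(congr1 (fun t => tnth t i)) := val_inj sP; rewrite !tnth_mktuple.
apply/andP; split; apply/forallP => i; rewrite ?sE//.
by have /(congr1 tag)/= -> := sE i.
Qed.

Lemma label_count_same_class m m' x :
  same_class m m' -> label_count m' x = label_count m x.
Proof.
case/existsP => s /andP[_ /forallP sm].
rewrite /label_count [RHS](reindex_inj (@perm_inj _ s))/=.
by apply: eq_bigr => i _; rewrite (eqP (sm i)).
Qed.

Lemma multi_class_eqP m (a : multi_class M l) :
  reflect (forall x, label_count m x = label_count (repr a) x) (\pi_(multi_class M l)%qT m == a).
Proof.
apply: (iffP idP) => [/eqP <- x|H].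
  by apply: label_count_same_class; apply/(@eqquotP _ _ (multi_class M l)); rewrite reprK.
by rewrite -[a]reprK eq_sym; apply/eqP/eqquotP; exact: label_count_perm.
Qed.

Definition replace_at m (i : 'I_N) (u : M (l i)) : multi_index M l :=
  finfun (eqtype.dfwith m u).

Lemma label_count_replace_at m (i : 'I_N) (u : M (l i)) x :
  (label_count (replace_at m u) x + (label m i == x) =
   label_count m x + (Tagged M u == x))%N.
Proof.
rewrite /label_count (bigD1 i)//= [in RHS](bigD1 i)//=.
rewrite {1}/label /replace_at ffunE eqtype.dfwith_in addnAC [RHS]addnAC addnC -addnA.
rewrite addnC [RHS]addnC -!addnA; congr (_ + _)%N.
rewrite [in RHS]addnC; congr (_ + _)%N.
by apply: eq_bigr => j ji; rewrite /label ffunE eqtype.dfwith_out 1?eq_sym.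
Qed.

(** The subtractive description of a replacement, in additive form on the counts of all
   labels. *)
Lemma replacementP (a b : multi_class M l) (j : 'I_(Nblocks l)) (p q : M (block_val j)) :
  is_replacement a (Tagged (fun j => (M (block_val j) * M (block_val j))%type) (p, q)) b <->
  p != q /\ forall x, (label_count (repr b) x + (Tagged M p == x) =
    label_count (repr a) x + (Tagged M q == x))%N.
Proof.
rewrite /is_replacement/= /lambda_class lambda_label_count.
split=> [/and3P[pq p0 /forallP H]|[pq H]].
  split=> // x.
  have [[j' [p' <-]]|[nb nx]] := label_count_block x.
    have /forallP/(_ p')/eqP := H j'; rewrite !lambda_label_count => ->.
    rewrite [Tagged M p' == Tagged M p]eq_sym [Tagged M p' == Tagged M q]eq_sym.
    by case: eqP => [<-|_] /=; lia.
  rewrite !nx.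
  have nP (p' : M (block_val j)) : (Tagged M p' == x) = false.
    by apply/eqP => px; apply: nb; exists j, p'.
  by rewrite !nP.
apply/and3P; split=> //.
  by have := H (Tagged M p); rewrite eqxx; case: eqP => [e|_]; [|lia];
    rewrite (eq_from_Tagged e) eqxx in pq.
apply/forallP => j'; apply/forallP => p'; rewrite !lambda_label_count; apply/eqP.
have := H (Tagged M p').
rewrite [Tagged M p' == Tagged M p]eq_sym [Tagged M p' == Tagged M q]eq_sym.
case: (eqVneq (Tagged M p) _) => [e1|_]; case: (eqVneq (Tagged M q) _) => [e2|_] /=; try lia.
by rewrite -e2 in e1; rewrite (eq_from_Tagged e1) eqxx in pq.
Qed.

(** Members of a that differ from the representative of b at the position i only are
   obtained by writing some u there. If a = b the counts force u to be the old value.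
   If b arises from a by replacing p by q, they force the old value to be q and u to be
   p, which leaves one term for each position carrying q. If b is not such a
   replacement there is no term. *)
Lemma class_derivative_sum (K : nzRingType) (f : forall x, M x -> M x -> K)
    (a b : multi_class M l) :
  \sum_(m : multi_index M l | \pi_(multi_class M l)%qT m == a) \sum_i
    (if [forall i', (i' != i) ==> (m i' == repr b i')] then f _ (repr b i) (m i) else 0) =
  if a == b then \sum_j f _ (repr a j) (repr a j)
  else if [pick z | is_replacement a z b] is Some (existT j (p, q)) then
    (lambda_class b q)%:R * f _ q p else 0.
Proof.
set b0 := repr b.
transitivity (\sum_i \sum_(u : M (l i))
    if \pi_(multi_class M l)%qT (replace_at b0 u) == a then f _ (b0 i) u else 0).
  rewrite exchange_big/=; apply: eq_bigr => i _.
  rewrite -big_mkcondr/= -[RHS]big_mkcond/=.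
  rewrite (reindex_onto (fun u : M (l i) => replace_at b0 u) (fun m => m i))/=.
    apply: eq_big => u; last by move=> _; rewrite /replace_at ffunE eqtype.dfwith_in.
    rewrite {3}/replace_at ffunE eqtype.dfwith_in eqxx andbT.
    case: eqP => //= _; apply/forallP => i'; apply/implyP => ii'.
    by rewrite /replace_at ffunE eqtype.dfwith_out 1?eq_sym.
  move=> m /andP[_ /forallP H]; apply/ffunP => i'; rewrite /replace_at ffunE.
  by case: eqtype.dfwithP => // i'' ii''; apply/esym/eqP; have /implyP := H i''; apply; rewrite eq_sym.
have cP i (u : M (l i)) : reflect (forall x, label_count b0 x + (Tagged M u == x) =
      label_count (repr a) x + (label b0 i == x))%N
    (\pi_(multi_class M l)%qT (replace_at b0 u) == a).
  apply: (iffP (multi_class_eqP _ _)) => H x.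
    by rewrite -label_count_replace_at H.
  by have := label_count_replace_at b0 u x; rewrite H => /addIn.
have [ab|nab] := eqVneq a b.
  have ra : repr a = b0 by rewrite ab.
  apply: eq_bigr => i _; rewrite ra (bigD1 (b0 i))//= ifT; last first.
    by apply/cP => x; rewrite ra.
  rewrite big1 ?addr0// => u ub; case: cP => // H.
  have := H (Tagged M u); rewrite ra eqxx => /addnI.
  case: eqP => // /eqP; rewrite eq_sym eq_Tagged/= => /eqP uu.
  by rewrite uu eqxx in ub.
case: pickP => [[j [p q]] /replacementP[pq H]|H]; last first.
  rewrite big1// => i _; rewrite big1// => u _; case: cP => // C; exfalso.
  have [j [p Pp]] := block_label u.
  have [j' [q Qq]] := block_label (b0 i).
  have jj : j' = j.
    have e1 : block_val j' = l i by have := congr1 tag Qq.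
    have e2 : block_val j = l i by have := congr1 tag Pp.
    apply/val_inj/eqP; rewrite -(nth_uniq (l i) (ltn_ord j') (ltn_ord j) (undup_uniq _)).
    by rewrite -[X in X == _](tnth_nth _ (in_tuple (block_values l)))
      -[X in _ == X](tnth_nth _ (in_tuple (block_values l))) -/(block_val j') e1 -/(block_val j) e2.
  subst j'.
  have /negP := H (Tagged (fun j => (M (block_val j) * M (block_val j))%type) (p, q)); apply.
  apply/replacementP; split; last first.
    by move=> x; rewrite Pp Qq; exact: C.
  apply: contra nab => /eqP pq; apply/eqP.
  rewrite -[b]reprK; apply/esym/eqP/multi_class_eqP => x.
  have := C x; rewrite -Pp -[label b0 i]Qq pq.
  by move/addIn.
pose g (x y : {x : calL & M x}) : K := f (tag x) (tagged x) (tagged_as x y).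
have gE i (u : M (l i)) : f _ (b0 i) u = g (label b0 i) (Tagged M u).
  by rewrite /g tagged_asE.
have -> : f _ q p = g (Tagged M q) (Tagged M p) by rewrite /g tagged_asE.
have PQ : (Tagged M p == Tagged M q) = false.
  by apply/eqP => e; rewrite (eq_from_Tagged e) eqxx in pq.
have C i (u : M (l i)) : (\pi_(multi_class M l)%qT (replace_at b0 u) == a) =
    (label b0 i == Tagged M q) && (Tagged M u == Tagged M p).
  apply/cP/andP => [C|[/eqP e1 /eqP e2] x]; last by rewrite e1 e2; exact: H.
  have E x : ((Tagged M u == x) + (Tagged M q == x) =
      (label b0 i == x) + (Tagged M p == x))%N.
    by have := C x; have := H x; rewrite -/b0; lia.
  have := E (Tagged M p); rewrite eqxx [Tagged M q == _]eq_sym PQ.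
  have := E (Tagged M q); rewrite eqxx PQ.
  case: (Tagged M u == Tagged M p); case: (label b0 i == Tagged M q);
    case: (Tagged M u == Tagged M q); case: (label b0 i == Tagged M p); try lia; try by [].
rewrite /lambda_class lambda_label_count -/b0 /label_count natr_sum mulr_suml.
apply: eq_bigr => i _; case: (eqVneq (label b0 i) (Tagged M q)) => [e|ne]; last first.
  rewrite mul0r big1// => u _; rewrite C (negPf ne).
  by [].
rewrite mul1r.
have [u0 uP] : exists u : M (l i), Tagged M u = Tagged M p.
  have E : block_val j = l i by have := congr1 tag e.
  have tr y : block_val j = y -> exists u : M y, Tagged M u = Tagged M p.
    by case: y /; exists p.
  exact: tr.
rewrite (bigD1 u0)//= C e uP !eqxx/= big1 ?addr0; first by rewrite gE e uP.
move=> u uu0; rewrite C e -uP eqxx/= eq_Tagged/= (negPf uu0).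
by [].
Qed.

End LabelCounts.

(** * Derivatives at 0 of scalar functions of a real variable *)

Section RealDerivative.
Variables (R : realType) (k : scalar_kind).
Local Notation K := (base_field R k).
Implicit Types f g : R -> K.

(** The value [real_derivative0] is a limit taken without a convergence hypothesis; the
   rules of calculus need the convergence itself. *)
Definition has_derivative0 f (a : K) :=
  (of_real k t)^-1 * (f t - f 0) @[t --> (0 : R)^'] --> a.

Lemma dnbhs0_id : (t : R) @[t --> (0 : R)^'] --> (0 : R).
Proof. exact: (cvg_within (fun t : R => t != 0)). Qed.

Lemma dnbhs0_neq : \forall t \near (0 : R)^', t != 0.
Proof. exact: withinT. Qed.

Lemma has_derivative0_val f a : has_derivative0 f a -> real_derivative0 f = a.
Proof. by move=> fa; apply: cvg_lim; [exact: norm_hausdorff|exact: fa]. Qed.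

Lemma has_derivative0_cvg f a : has_derivative0 f a -> f t @[t --> (0 : R)^'] --> f 0.
Proof.
move=> fa.
have t0 : of_real k t @[t --> (0 : R)^'] --> (0 : K).
  apply/cvg_absK; have H : `|t| @[t --> (0 : R)^'] --> `|0 : R|.
    by apply: cvg_norm; exact: dnbhs0_id.
  rewrite normr0 in H; apply: cvg_trans H; apply: near_eq_cvg; apply: nearW => t.
  by rewrite subr0 absK_real.
have H : of_real k t * ((of_real k t)^-1 * (f t - f 0)) + f 0 @[t --> (0 : R)^'] -->
    0 * a + f 0.
  by apply: cvgD; [apply: cvgM|exact: cvg_cst].
rewrite mul0r add0r in H; apply: cvg_trans H; apply: near_eq_cvg.
apply: filterS dnbhs0_neq => t t0'.
by rewrite mulVKf ?of_real_eq0// subrK.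
Qed.

Lemma has_derivative0_cst c : has_derivative0 (fun=> c) 0.
Proof.
rewrite /has_derivative0; under eq_fun do rewrite subrr mulr0.
exact: cvg_cst.
Qed.

Lemma has_derivative0D f g a b : has_derivative0 f a -> has_derivative0 g b ->
  has_derivative0 (fun t => f t + g t) (a + b).
Proof.
move=> fa gb.
have H : (of_real k t)^-1 * (f t - f 0) + (of_real k t)^-1 * (g t - g 0)
    @[t --> (0 : R)^'] --> a + b by exact: cvgD.
apply: cvg_trans H; apply: near_eq_cvg.
by apply: nearW => t /=; rewrite -mulrDr opprD addrACA.
Qed.

Lemma has_derivative0M f g a b : has_derivative0 f a -> has_derivative0 g b ->
  has_derivative0 (fun t => f t * g t) (a * g 0 + f 0 * b).
Proof.
move=> fa gb.
have H : (of_real k t)^-1 * (f t - f 0) * g t + f 0 * ((of_real k t)^-1 * (g t - g 0))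
    @[t --> (0 : R)^'] --> a * g 0 + f 0 * b.
  apply: cvgD; first by apply: cvgM => //; exact: has_derivative0_cvg gb.
  by apply: cvgM => //; exact: cvg_cst.
apply: cvg_trans H; apply: near_eq_cvg; apply: nearW => t /=.
by ring.
Qed.

Lemma has_derivative0_sum (I : Type) (r : seq I) (P : pred I) (f : I -> R -> K) (a : I -> K) :
  (forall i, has_derivative0 (f i) (a i)) ->
  has_derivative0 (fun t => \sum_(i <- r | P i) f i t) (\sum_(i <- r | P i) a i).
Proof.
move=> fa; elim: r => [|i r IH].
  by rewrite big_nil; under eq_fun do rewrite big_nil; exact: has_derivative0_cst.
rewrite big_cons; under eq_fun do rewrite big_cons.
by case: (P i) => //; exact: has_derivative0D.
Qed.

Lemma has_derivative0_prod (I : finType) (f : I -> R -> K) (a : I -> K) :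
  (forall i, has_derivative0 (f i) (a i)) ->
  has_derivative0 (fun t => \prod_i f i t)
    (\sum_i a i * \prod_(i' | i' != i) f i' 0).
Proof.
move=> fa.
suff H r : uniq r -> has_derivative0 (fun t => \prod_(i <- r) f i t)
    (\sum_(i <- r) a i * \prod_(i' <- r | i' != i) f i' 0).
  exact: (H _ (index_enum_uniq I)).
elim: r => [_|i r IH /= /andP[ir ur]].
  by rewrite big_nil; under eq_fun do rewrite big_nil; exact: has_derivative0_cst.
under eq_fun do rewrite big_cons.
rewrite big_cons big_cons eqxx/=.
rewrite (_ : _ + _ = a i * (\prod_(i' <- r) f i' 0) +
    f i 0 * \sum_(i0 <- r) a i0 * \prod_(i' <- r | i' != i0) f i' 0).
  by apply: has_derivative0M => //; exact: IH.
congr (_ * _ + _).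
  rewrite [LHS]big_seq_cond [RHS]big_seq_cond; apply: eq_bigl => i'.
  by case: (eqVneq i' i) => [->|_]; rewrite ?(negPf ir).
rewrite mulr_sumr big_seq [RHS]big_seq; apply: eq_bigr => i0 i0r.
rewrite big_cons ifT; first by rewrite mulrCA.
by apply: contraNneq ir => ->.
Qed.

Lemma has_derivative0_expm n (A : 'M[K]_n) i j :
  has_derivative0 (fun t => expm (of_real k t *: A) i j) (A i j).
Proof.
have H : mcvg (0 : R)^' (diff_quotient id (fun t : R => expm (of_real k t *: A))) A.
  by apply: mcvg_diff_quotient_expm; [exact: dnbhs0_neq|exact: dnbhs0_id].
have : diff_quotient id (fun t : R => expm (of_real k t *: A)) t i j @[t --> (0 : R)^'] --> A i j.
  by apply/cvg_absK; exact: mcvg_entry.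
apply: cvg_trans; apply: near_eq_cvg; apply: nearW => t; rewrite /diff_quotient rmorph0 scale0r expm0 !mxE fmorphV.
by [].
Qed.

Lemma cvgK_sum (T I : Type) (F : set_system T) {FF : Filter F} (r : seq I) (P : pred I)
    (f : I -> T -> K) (a : I -> K) : (forall i, f i t @[t --> F] --> a i) ->
  \sum_(i <- r | P i) f i t @[t --> F] --> \sum_(i <- r | P i) a i.
Proof.
move=> fa; elim: r => [|i r IH].
  by rewrite big_nil; under eq_fun do rewrite big_nil; exact: cvg_cst.
rewrite big_cons; under eq_fun do rewrite big_cons.
by case: (P i) => //; apply: cvgD.
Qed.

Lemma cvgK_prod (T I : Type) (F : set_system T) {FF : Filter F} (r : seq I) (P : pred I)
    (f : I -> T -> K) (a : I -> K) : (forall i, f i t @[t --> F] --> a i) ->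
  \prod_(i <- r | P i) f i t @[t --> F] --> \prod_(i <- r | P i) a i.
Proof.
move=> fa; elim: r => [|i r IH].
  by rewrite big_nil; under eq_fun do rewrite big_nil; exact: cvg_cst.
rewrite big_cons; under eq_fun do rewrite big_cons.
by case: (P i) => //; apply: cvgM.
Qed.

End RealDerivative.

(** * Continuous matrix representations *)

Section Representations.
Variables (R : realType) (k k0 : scalar_kind) (n : nat).
Local Notation K := (base_field R k).
Local Notation K0 := (base_field R k0).
Variables (G : set 'M[K0]_n) (J : finType) (rho : 'M[K0]_n -> J -> J -> K).
Hypothesis rhoG : matrix_representation G rho.

Lemma representation_cvg (T : Type) (F : set_system T) {FF : Filter F}
    (h : T -> 'M[K0]_n) g i j : (\forall t \near F, G (h t)) -> G g ->
  mcvg F h g -> rho (h t) i j @[t --> F] --> rho g i j.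
Proof.
move=> Gh Gg /cvg_mcvg hg; have [_ _ /(_ i j) /subspace_continuousP /(_ _ Gg)] := rhoG.
apply: cvg_comp => B /hg; apply: filterS2 Gh.
by move=> t Gt; exact.
Qed.

Lemma representation_one_parameter (X : 'M[K0]_n) : Lie_algebra G X ->
  exists A : 'M[K]_#|J|, forall (t : R) i j,
    rho (expm (of_real k0 t *: X)) i j =
    expm (of_real k t *: A) (enum_rank i) (enum_rank j).
Proof.
move=> GX; have [rho1 rhoM _] := rhoG.
pose U (t : R) : 'M[K]_#|J| := \matrix_(i, j)
  rho (expm (of_real k0 t *: X)) (enum_val i) (enum_val j).
have U0 : U 0 = 1.
  apply/matrixP => i j; rewrite !mxE rmorph0 scale0r expm0 rho1.
  by rewrite (inj_eq enum_val_inj).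
have UD s t : U (s + t) = U s * U t.
  apply/matrixP => i j; rewrite !mxE expmD rhoM; [|exact: GX..].
  rewrite (big_enum_val (fun p => rho _ _ p * rho _ p _))/=.
  by apply: eq_bigr => p _; rewrite !mxE.
have Uc : mcvg (nbhs (0 : R)) U 1.
  rewrite -U0; apply: mcvg_entries => i j; apply/cvg_absK; rewrite mxE.
  under eq_fun do rewrite mxE.
  apply: representation_cvg; [by apply: nearW => t; exact: GX|exact: GX|].
  exact: mcvg_expm.
have [A UA] := one_parameter_group U0 UD Uc.
by exists A => t i j; rewrite -UA mxE !enum_rankK.
Qed.

End Representations.

(** * The action of the group on coefficient vectors *)

Section ActionOnCoefficients.
Context {R : realType} {k k0 : scalar_kind} {n : nat}.
Local Notation K := (base_field R k).
Local Notation K0 := (base_field R k0).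
Variable G : set 'M[K0]_n.
Hypothesis GLie : linear_Lie_group G.
Context {Omega : Type} {F : comAlgType K}.
Variable act : 'M[K0]_n -> Omega -> Omega.
Hypothesis actG : group_action G act.
Context {dL dM : Order.disp_t} {calL : orderType dL}.
Context {M : calL -> finOrderType dM}.
Variable phi : forall l : calL, M l -> Omega -> F.
Variable rho : forall l : calL, 'M[K0]_n -> M l -> M l -> K.
Hypothesis rhoG : forall l : calL, matrix_representation G (@rho l).
Hypothesis phi_stable : stable_with_representation G act phi rho.
Context {N : nat}.
Variable l : 'I_N -> calL.
Variable L : calL.
Hypothesis phibar_free : forall c : multi_class M l -> K,
  \sum_a c a *: phibar_class phi a = 0 -> forall a, c a = 0.
Local Notation I := (multi_class M l * M L)%type.
Implicit Types (a b : multi_class M l) (r : 'I_N -> Omega) (c : 'cV[K]_#|{: I}|).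
Implicit Types g h : 'M[K0]_n.

(** The matrix of the action on symmetric products: the entries of the tensor product
   of the representations, summed over the multi-indices of a class. *)
Definition class_action g b a : K :=
  \sum_(m : multi_index M l | \pi_(multi_class M l)%qT m == a)
    \prod_i rho g (repr b i) (m i).

Local Notation coef c a kk := (c (enum_rank (a, kk)) 0).
Local Notation move_points g r := (fun i => act g (r i)).

Lemma phibar_pi (m : multi_index M l) :
  phibar phi m = phibar_class phi (\pi_(multi_class M l)%qT m).
Proof.
apply/esym/phibar_same_class; rewrite /=.
by apply/(@eqquotP _ _ (multi_class M l)); rewrite reprK.
Qed.

Lemma phibar_class_act g b r : G g ->
  phibar_class phi b (move_points g r) =
  \sum_a class_action g b a *: phibar_class phi a r.
Proof.
move=> Gg; rewrite /phibar_class /phibar.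
transitivity (\prod_i \sum_(p : M (l i)) rho g (repr b i) p *: \sum_j phi p (r j)).
  apply: eq_bigr => i _; under eq_bigr do rewrite (phi_stable Gg).
  by rewrite exchange_big/=; apply: eq_bigr => p _; rewrite scaler_sumr.
rewrite bigA_distr_dffun.
rewrite (partition_big (fun m : multi_index M l => \pi_(multi_class M l)%qT m) xpredT)//=.
apply: eq_bigr => a _; rewrite /class_action scaler_suml; apply: eq_bigr => m /eqP ma.
rewrite scaler_prod; congr (_ *: _).
by rewrite -[LHS]/(phibar phi m r) phibar_pi ma.
Qed.

Lemma equivariant_of_coefE c kk r :
  equivariant_of_coef phi c kk r = \sum_a coef c a kk *: phibar_class phi a r.
Proof. by rewrite /equivariant_of_coef fct_sumE. Qed.

Lemma phibar_class_inj (x y : multi_class M l -> K) :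
  (forall r, \sum_a x a *: phibar_class phi a r = \sum_a y a *: phibar_class phi a r) ->
  forall a, x a = y a.
Proof.
move=> H a; apply/eqP; rewrite -subr_eq0; apply/eqP; move: a; apply: phibar_free.
apply/funext => r; rewrite fct_sumE.
transitivity (\sum_a (x a *: phibar_class phi a r - y a *: phibar_class phi a r)).
  by apply: eq_bigr => a _; rewrite -scalerBl.
by rewrite sumrB H subrr.
Qed.

Lemma equivariant_of_coef_inj c c' :
  (forall kk r, equivariant_of_coef phi c kk r = equivariant_of_coef phi c' kk r) ->
  c = c'.
Proof.
move=> H; apply/matrixP => i j; rewrite ord1 -(enum_valK i).
case: (enum_val i) => a kk; move: a; apply: phibar_class_inj => r.
by have := H kk r; rewrite !equivariant_of_coefE.
Qed.

Lemma equivariant_of_coef_act g c kk r : G g ->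
  equivariant_of_coef phi c kk (move_points g r) =
  \sum_a (\sum_b coef c b kk * class_action g b a) *: phibar_class phi a r.
Proof.
move=> Gg; rewrite equivariant_of_coefE.
under eq_bigr do rewrite (phibar_class_act _ _ Gg) scaler_sumr.
rewrite exchange_big/=; apply: eq_bigr => a _; rewrite scaler_suml.
by apply: eq_bigr => b _; rewrite scalerA.
Qed.

Definition equivariant_at g c := forall r kk,
  equivariant_of_coef phi c kk (move_points g r) =
  \sum_(kk' : M L) rho g kk kk' *: equivariant_of_coef phi c kk' r.

Lemma equivariant_atE g c : G g ->
  equivariant_at g c <-> forall a kk,
    \sum_b coef c b kk * class_action g b a = \sum_(kk' : M L) rho g kk kk' * coef c a kk'.
Proof.
move=> Gg.
have E r kk : \sum_(kk' : M L) rho g kk kk' *: equivariant_of_coef phi c kk' r =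
    \sum_a (\sum_(kk' : M L) rho g kk kk' * coef c a kk') *: phibar_class phi a r.
  under eq_bigr do rewrite equivariant_of_coefE scaler_sumr.
  rewrite exchange_big/=; apply: eq_bigr => a _; rewrite scaler_suml.
  by apply: eq_bigr => b _; rewrite scalerA.
split=> [H a kk|H r kk].
  move: a; apply: phibar_class_inj => r.
  by have := H r kk; rewrite E equivariant_of_coef_act.
rewrite E equivariant_of_coef_act//; apply: eq_bigr => a _.
by rewrite H.
Qed.

Lemma class_action_cvg (T : Type) (FF : set_system T) {FFF : Filter FF}
    (h : T -> 'M[K0]_n) g b a : (\forall t \near FF, G (h t)) -> G g -> mcvg FF h g ->
  class_action (h t) b a @[t --> FF] --> class_action g b a.
Proof.
move=> Gh Gg hg; apply: cvgK_sum => m; apply: cvgK_prod => i.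
exact: representation_cvg.
Qed.

(** The subgroup properties are seen on functions. Closedness is seen on coefficients,
   where equivariance at g is a system of equations between continuous functions
   of g in G. *)
Lemma equivariance_group c : linear_Lie_group [set g | G g /\ equivariant_at g c].
Proof.
have [Gu G1 GM GV cl] := GLie; have [act1 actM] := actG.
split=> [g [/Gu]//| |g h [Gg gc] [Gh hc]|g [Gg gc]|].
- split=> // r kk; have [rho1 _ _] := rhoG L.
  rewrite (_ : (fun i => _) = r); last by apply/funext => i; rewrite act1.
  under eq_bigr do rewrite rho1.
  rewrite (bigD1 kk)//= eqxx scale1r big1 ?addr0// => kk' kkk'.
  by rewrite eq_sym (negPf kkk') scale0r.
- split; [exact: GM|move=> r kk]; have [_ rhoM _] := rhoG L.
  rewrite (_ : (fun i => _) = move_points g (move_points h r)); last first.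
    by apply/funext => i; rewrite actM.
  rewrite gc; under eq_bigr do rewrite hc scaler_sumr.
  rewrite exchange_big/=; apply: eq_bigr => kk' _; rewrite rhoM// scaler_suml.
  by apply: eq_bigr => p _; rewrite scalerA.
- split; [exact: GV|move=> r kk]; have [rho1 rhoM _] := rhoG L.
  have Gi := GV _ Gg.
  have H p : equivariant_of_coef phi c p r = \sum_(kk' : M L) rho g p kk' *:
      equivariant_of_coef phi c kk' (move_points (invmx g) r).
    rewrite -gc; congr (equivariant_of_coef phi c p _); apply/funext => i.
    by rewrite -actM// mulmxV ?act1// Gu.
  under eq_bigr do rewrite H scaler_sumr.
  rewrite exchange_big/= (bigD1 kk)//= [X in _ + X]big1 ?addr0; last first.
    move=> kk' kkk'; under eq_bigr do rewrite scalerA.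
    rewrite -scaler_suml -rhoM// mulVmx ?Gu// rho1 eq_sym (negPf kkk').
    by rewrite scale0r.
  under eq_bigr do rewrite scalerA.
  by rewrite -scaler_suml -rhoM// mulVmx ?Gu// rho1 eqxx scale1r.
move=> g [cg ug].
have Gg : G g.
  by apply: cl; split=> // B /cg [h [[Gh _] Bh]]; exists h.
split=> //; apply/(equivariant_atE _ Gg) => a kk.
pose S := [set h | G h /\ equivariant_at h c].
have PF : ProperFilter (within S (nbhs g)).
  apply: Build_ProperFilter_ex => B /= HB.
  by have [h [Sh Bh]] := cg _ HB; exists h; exact: Bh.
have near_S : \forall h \near within S (nbhs g), S h by exact: withinT.
have near_G : \forall h \near within S (nbhs g), G h.
  by apply: filterS near_S => h [].
have idg : mcvg (within S (nbhs g)) id g by apply/cvg_mcvg; exact: cvg_within.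
have lc : \sum_b coef c b kk * class_action h b a @[h --> within S (nbhs g)] -->
    \sum_b coef c b kk * class_action g b a.
  apply: cvgK_sum => b; apply: cvgM; first exact: cvg_cst.
  exact: class_action_cvg.
have rc : \sum_(kk' : M L) rho h kk kk' * coef c a kk' @[h --> within S (nbhs g)] -->
    \sum_(kk' : M L) rho g kk kk' * coef c a kk'.
  apply: cvgK_sum => kk'; apply: cvgM; last exact: cvg_cst.
  exact: (representation_cvg (rhoG L)).
have rc' : \sum_b coef c b kk * class_action h b a @[h --> within S (nbhs g)] -->
    \sum_(kk' : M L) rho g kk kk' * coef c a kk'.
  apply: cvg_trans rc; apply: near_eq_cvg; apply: filterS near_S => h [Gh hc].
  by have /(equivariant_atE _ Gh) -> := hc.
by rewrite -(cvg_lim (@norm_hausdorff _ _) lc) (cvg_lim (@norm_hausdorff _ _) rc').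
Qed.

(** With g' the inverse of g this is the action on coefficient vectors of the map taking
   f to rho(g)^-1 f (g .), whose fixed points are the equivariant functions. As g' is a
   separate argument, it can be given as exp (- t X) when g is exp (t X). *)
Definition coef_action g' g : 'M[K]_#|{: I}| := \matrix_(x, y)
  (rho g' (enum_val x).2 (enum_val y).2 *
   class_action g (enum_val y).1 (enum_val x).1).

Lemma coef_actionE g' g c a kk : coef (coef_action g' g *m c) a kk =
  \sum_(kk' : M L) rho g' kk kk' * \sum_b coef c b kk' * class_action g b a.
Proof.
rewrite !mxE; under eq_bigr do rewrite !mxE enum_rankK/=.
pose f (y : I) := rho g' kk y.2 * class_action g y.1 a * c (enum_rank y) 0.
transitivity (\sum_(i < #|{: I}|) f (enum_val i)).
  by apply: eq_bigr => i _; rewrite /f enum_valK.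
rewrite -(big_enum_val f)/=.
transitivity (\sum_(b : multi_class M l) \sum_(kk' : M L) f (b, kk')).
  by rewrite pair_big/=; apply: eq_bigr => -[].
rewrite exchange_big/=.
apply: eq_bigr => kk' _; rewrite mulr_sumr; apply: eq_bigr => b _.
by rewrite /f/=; ring.
Qed.

Lemma coef_action_fun g' g c kk r : G g ->
  equivariant_of_coef phi (coef_action g' g *m c) kk r =
  \sum_(kk' : M L) rho g' kk kk' *: equivariant_of_coef phi c kk' (move_points g r).
Proof.
move=> Gg; rewrite equivariant_of_coefE.
under [RHS]eq_bigr do rewrite equivariant_of_coef_act// scaler_sumr.
rewrite [RHS]exchange_big/=; apply: eq_bigr => a _.
rewrite coef_actionE scaler_suml; apply: eq_bigr => kk' _.
by rewrite scalerA.
Qed.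

Lemma eq_mulmx_col (A B : 'M[K]_#|{: I}|) :
  (forall c : 'cV[K]_#|{: I}|, A *m c = B *m c) -> A = B.
Proof.
by move=> H; apply/matrixP => i j; have /matrixP/(_ i 0) := H (delta_mx j 0);
  rewrite -!colE !mxE.
Qed.

Lemma coef_action1 : coef_action 1 1 = 1.
Proof.
have [_ G1 _ _ _] := GLie; have [act1 _] := actG; have [rho1 _ _] := rhoG L.
apply: eq_mulmx_col => c; rewrite mul1mx; apply: equivariant_of_coef_inj => kk r.
rewrite coef_action_fun//; under eq_bigr do rewrite rho1.
rewrite (bigD1 kk)//= eqxx scale1r big1 ?addr0 => [|kk' kkk']; last first.
  by rewrite eq_sym (negPf kkk') scale0r.
by congr (equivariant_of_coef phi c kk _); apply/funext => i; rewrite act1.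
Qed.

(** Both sides represent the same transformation of functions, and coefficients are
   determined by functions. *)
Lemma coef_actionM g1' g1 g2' g2 : G g1 -> G g2 -> G g1' -> G g2' ->
  coef_action (g1' * g2') (g2 * g1) = coef_action g1' g1 * coef_action g2' g2.
Proof.
move=> Gg1 Gg2 Gg1' Gg2'; have [_ _ GM _ _] := GLie.
have [_ actM] := actG; have [_ rhoM _] := rhoG L.
apply: eq_mulmx_col => c; rewrite -[_ * coef_action g2' g2]/(_ *m _) -mulmxA.
apply: equivariant_of_coef_inj => kk r.
rewrite coef_action_fun; last exact: GM.
rewrite coef_action_fun//; under [RHS]eq_bigr do rewrite coef_action_fun// scaler_sumr.
rewrite [RHS]exchange_big/=; apply: eq_bigr => kk' _.
rewrite rhoM// scaler_suml; apply: eq_bigr => p _; rewrite scalerA; congr (_ *: _).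
by congr (equivariant_of_coef phi c kk' _); apply/funext => i; rewrite actM.
Qed.

End ActionOnCoefficients.

(** * The infinitesimal action and its kernel *)

Section FixedVectors.
Variables (R : realType) (k : scalar_kind) (n : nat).
Local Notation K := (base_field R k).

Lemma expm_fix (A : 'M[K]_n) (c : 'cV[K]_n) : A *m c = 0 -> expm A *m c = c.
Proof.
move=> Ac; apply/matrixP => i j; rewrite !mxE.
have partial N : expm_partial A N.+1 *m c = c.
  elim: N => [|N IH].
    by rewrite /expm_partial /series/= big_nat1 expr0 fact0 invr1 scale1r mul1mx.
  rewrite /expm_partial /series/= big_nat_recr//= mulmxDl -[X in X + _]/(expm_partial A N.+1 *m c) IH.
  by rewrite exprSr -[A ^+ N * A]/(A ^+ N *m A) -scalemxAl -mulmxA Ac mulmx0 scaler0 addr0.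
have H : \sum_p expm_partial A N i p * c p j @[N --> \oo] --> \sum_p expm A i p * c p j.
  apply: cvgK_sum => p; apply: cvgM; last exact: cvg_cst.
  by apply/cvg_absK; apply: mcvg_entry; exact: expm_partial_cvg.
rewrite -(cvg_lim (@norm_hausdorff _ _) H).
apply: cvg_lim; first exact: norm_hausdorff.
apply: cvg_near_cst; exists 1%N => // -[//|N] _.
by have /matrixP/(_ i j) := partial N; rewrite !mxE.
Qed.

Lemma expm_fix_derivative (A : 'M[K]_n) (c : 'cV[K]_n) :
  (forall t : R, expm (of_real k t *: A) *m c = c) -> A *m c = 0.
Proof.
move=> H; apply/matrixP => i j; rewrite !mxE.
have D : has_derivative0 (fun t : R => \sum_p expm (of_real k t *: A) i p * c p j)
    (\sum_p A i p * c p j).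
  apply: has_derivative0_sum => p.
  rewrite (_ : A i p * c p j = A i p * c p j + expm (of_real k 0 *: A) i p * 0).
    by apply: has_derivative0M; [exact: has_derivative0_expm|exact: has_derivative0_cst].
  by rewrite mulr0 addr0.
rewrite -(has_derivative0_val D).
rewrite (_ : (fun t : R => _) = fun=> c i j); last first.
  by apply/funext => t; have /matrixP/(_ i j) := H t; rewrite !mxE.
exact: has_derivative0_val (has_derivative0_cst (c i j)).
Qed.

End FixedVectors.

Section InfinitesimalAction.
Context {R : realType} {k k0 : scalar_kind} {n : nat}.
Local Notation K := (base_field R k).
Local Notation K0 := (base_field R k0).
Variable G : set 'M[K0]_n.
Hypothesis GLie : linear_Lie_group G.
Hypothesis Gconn : connected G.
Context {Ndim : nat}.
Variable X : 'I_Ndim -> 'M[K0]_n.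
Hypothesis XG : Lie_generators G X.
Context {Omega : Type} {F : comAlgType K}.
Variable act : 'M[K0]_n -> Omega -> Omega.
Hypothesis actG : group_action G act.
Context {dL dM : Order.disp_t} {calL : orderType dL}.
Context {M : calL -> finOrderType dM}.
Variable phi : forall l : calL, M l -> Omega -> F.
Variable rho : forall l : calL, 'M[K0]_n -> M l -> M l -> K.
Hypothesis rhoG : forall l : calL, matrix_representation G (@rho l).
Hypothesis phi_stable : stable_with_representation G act phi rho.
Context {N : nat}.
Variable l : 'I_N -> calL.
Variable L : calL.
Hypothesis phibar_free : forall c : multi_class M l -> K,
  \sum_a c a *: phibar_class phi a = 0 -> forall a, c a = 0.
Local Notation I := (multi_class M l * M L)%type.
Implicit Types (a b : multi_class M l) (r : 'I_N -> Omega) (c : 'cV[K]_#|{: I}|).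

Local Notation flow d t := (expm (of_real k0 t *: X d)).

Lemma flow_in d t : G (flow d t).
Proof. by have [GX _] := XG; exact: GX. Qed.

Lemma rho_derivative (l' : calL) d (i j : M l') :
  has_derivative0 (fun t : R => rho (flow d t) i j) (varrho X rho d i j) /\
  has_derivative0 (fun t : R => rho (flow d (- t)) i j) (- varrho X rho d i j).
Proof.
have [GX _] := XG; have [A rA] := representation_one_parameter (rhoG l') (GX d).
have D : has_derivative0 (fun t : R => rho (flow d t) i j) (A (enum_rank i) (enum_rank j)).
  by under eq_fun do rewrite rA; exact: has_derivative0_expm.
have -> : varrho X rho d i j = A (enum_rank i) (enum_rank j) by exact: has_derivative0_val D.
split=> //.
have DN := @has_derivative0_expm R k _ (- A) (enum_rank i) (enum_rank j).
rewrite mxE in DN; apply: cvg_trans DN; apply: near_eq_cvg; apply: nearW => t.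
by rewrite !rA rmorphN scaleNr scalerN oppr0 -scalerN rmorph0 !scale0r.
Qed.

Lemma rho1 (l' : calL) (i j : M l') : rho (1 : 'M[K0]_n) i j = (i == j)%:R.
Proof. by have [H _ _] := rhoG l'; exact: H. Qed.

Lemma class_action_at1 b a : class_action rho (1 : 'M[K0]_n) b a = (a == b)%:R.
Proof.
rewrite /class_action.
have E (m : multi_index M l) : \prod_i rho (1 : 'M[K0]_n) (repr b i) (m i) = (m == repr b)%:R.
  have [->|ne] := eqVneq m (repr b).
    by rewrite big1// => i _; rewrite rho1 eqxx.
  have [i ni] : exists i, m i != repr b i.
    apply/existsP; apply: contraR ne; rewrite negb_exists => /forallP H.
    by apply/eqP/ffunP => i; apply/eqP; have := H i; rewrite negbK.
  by rewrite (bigD1 i)//= rho1 eq_sym (negPf ni) mul0r.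
under eq_bigr do rewrite E.
have [->|ab] := eqVneq a b.
  rewrite (bigD1 (repr b)) ?reprK//= eqxx big1 ?addr0// => m /andP[_ /negPf ->].
  by [].
rewrite big1// => m /eqP ma; case: eqP => // mb.
by rewrite -ma mb reprK eqxx in ab.
Qed.

Lemma class_action_derivative d b a :
  has_derivative0 (fun t : R => class_action rho (flow d t) b a)
    (if a == b then \sum_j varrho X rho d (repr a j) (repr a j)
     else if [pick z | is_replacement a z b] is Some (existT j (p, q)) then
       (lambda_class b q)%:R * varrho X rho d q p else 0).
Proof.
rewrite -(class_derivative_sum (fun l' => varrho X rho (l := l') d)).
apply: has_derivative0_sum => m.
rewrite (_ : \sum_i _ = \sum_i varrho X rho d (repr b i) (m i) *
    \prod_(i' | i' != i) rho (flow d 0) (repr b i') (m i')).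
  by apply: has_derivative0_prod => i; have [] := rho_derivative d (repr b i) (m i).
apply: eq_bigr => i _; rewrite rmorph0 scale0r expm0.
have [/forallP H|] := boolP [forall i', (i' != i) ==> (m i' == repr b i')].
  rewrite big1 ?mulr1// => i' ii'; rewrite rho1 eq_sym.
  by have /implyP/(_ ii') -> := H i'.
rewrite negb_forall => /existsP[i']; rewrite negb_imply => /andP[ii' ne].
by rewrite (bigD1 i')//= rho1 eq_sym (negPf ne) mul0r mulr0.
Qed.

(** The left-hand side is a continuous one-parameter group, hence exp (t B), and B is its
   derivative at 0. In the entry at (a, kk), (b, kk'), the product rule gives the
   derivative of rho^L (exp (- t X_d)) when a = b, and the derivative of the action on
   classes when kk = kk'. *)
Lemma coef_action_flow d (t : R) :
  coef_action rho l L (flow d (- t)) (flow d t) = expm (of_real k t *: M_block X rho l L d).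
Proof.
pose U (t : R) : 'M[K]_#|{: I}| := coef_action rho l L (flow d (- t)) (flow d t).
have flow0 : flow d 0 = 1 by rewrite rmorph0 scale0r expm0.
have U0 : U 0 = 1.
  by rewrite /U oppr0 flow0; exact: (coef_action1 GLie actG rhoG phi_stable L phibar_free).
have UD s s' : U (s + s') = U s * U s'.
  rewrite /U opprD [s + s']addrC !expmD.
  by apply: (coef_actionM GLie actG rhoG phi_stable L phibar_free); exact: flow_in.
have Uc : mcvg (nbhs (0 : R)) U 1.
  rewrite -U0; apply: mcvg_entries => i j; apply/cvg_absK; rewrite mxE.
  under eq_fun do rewrite mxE.
  apply: cvgM.
    apply: (representation_cvg (rhoG L)); [by apply: nearW => s; exact: flow_in|exact: flow_in|].
    by apply: mcvg_expm; apply: cvgN.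
  apply: class_action_cvg => //; [by apply: nearW => s; exact: flow_in|exact: flow_in|].
  exact: mcvg_expm.
have [B UB] := one_parameter_group U0 UD Uc.
suff <- : B = M_block X rho l L d by rewrite -UB.
apply/matrixP => x y.
rewrite -(has_derivative0_val (@has_derivative0_expm R k _ B x y)).
have D : has_derivative0 (fun t : R => U t x y)
    (- varrho X rho d (enum_val x).2 (enum_val y).2 *
       class_action rho (flow d 0) (enum_val y).1 (enum_val x).1 +
     rho (flow d (- 0)) (enum_val x).2 (enum_val y).2 *
       (if (enum_val x).1 == (enum_val y).1 then
          \sum_j varrho X rho d (repr (enum_val x).1 j) (repr (enum_val x).1 j)
        else if [pick z | is_replacement (enum_val x).1 z (enum_val y).1]
          is Some (existT j (p, q)) then
          (lambda_class (enum_val y).1 q)%:R * varrho X rho d q p else 0)).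
  rewrite /U; under eq_fun do rewrite mxE.
  apply: has_derivative0M; last exact: class_action_derivative.
  by have [] := rho_derivative d (enum_val x).2 (enum_val y).2.
rewrite (_ : (fun t : R => _) = (fun t => U t x y)); last first.
  by apply/funext => s; rewrite UB.
rewrite (has_derivative0_val D).
rewrite mxE oppr0 flow0 class_action_at1 rho1 /M_entry.
case: (enum_val x) (enum_val y) => [a kk] [b kk'] /=.
case: (a == b); case: (eqVneq kk kk') => [<-|_] /=; rewrite ?mulr1 ?mulr0 ?mul1r ?mul0r ?addr0 ?add0r//.
by rewrite addrC.
Qed.

(** The kernel consists of the vectors fixed by the flows of all X_d, that is, of those
   whose function is equivariant along the one-parameter groups generating G. *)
Lemma kerM_equivariant c :
  c \in kerM X rho l L <-> forall g, G g -> equivariant_at act phi rho g c.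
Proof.
have [_ G1 GM GV _] := GLie; have [act1 actM] := actG.
have flowN d (t : R) r : (fun i => act (flow d t) (act (flow d (- t)) (r i))) = r.
  apply/funext => i; rewrite -actM; [|exact: flow_in..].
  by rewrite -[_ *m _]/(flow d t * flow d (- t)) expmN act1.
have -> : c \in kerM X rho l L <-> forall d, M_block X rho l L d *m c = 0.
  rewrite /kerM memv_ker lfunE/= /M_stacked mxcol_mul.
  split=> [/eqP|H].
    by rewrite -[X in _ = X]mxcol0 => /eq_mxcolP.
  by apply/eqP; rewrite -[X in _ = X]mxcol0; apply/eq_mxcolP.
have fixE : (forall d, M_block X rho l L d *m c = 0) <->
    forall d (t : R), coef_action rho l L (flow d (- t)) (flow d t) *m c = c.
  split=> [H d t|H d].
    by rewrite coef_action_flow; apply: expm_fix; rewrite -scalemxAl H scaler0.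
  by apply: expm_fix_derivative => t; rewrite -coef_action_flow.
rewrite fixE; split=> [H|H d t]; last first.
  apply: (equivariant_of_coef_inj phibar_free) => kk r.
  rewrite (coef_action_fun phi_stable)//; last exact: flow_in.
  rewrite -(H _ (flow_in d (- t))); congr (equivariant_of_coef phi c kk _).
  by rewrite -[RHS](flowN d (- t)) opprK.
suff GE : [set g | G g /\ equivariant_at act phi rho g c] = G.
  by move=> g; rewrite -{1}GE => -[].
apply: (Lie_generators_closed_subgroup GLie Gconn XG).
- exact: equivariance_group.
- by move=> g [].
move=> d t; split; [exact: flow_in|move=> r kk].
have := congr1 (fun c => equivariant_of_coef phi c kk (fun i => act (flow d t) (r i))) (H d (- t)).
rewrite (coef_action_fun phi_stable); last exact: flow_in.
rewrite opprK => <-; apply: eq_bigr => kk' _; congr (_ *: equivariant_of_coef phi c kk' _).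
by rewrite -[RHS](flowN d (- t)) opprK.
Qed.

End InfinitesimalAction.

(** * The basis theorem *)

Section CoefficientFunctions.
Context {R : realType} {k : scalar_kind}.
Local Notation K := (base_field R k).
Context {Omega : Type} {F : comAlgType K}.
Context {dL dM : Order.disp_t} {calL : orderType dL}.
Context {M : calL -> finOrderType dM}.
Variable phi : forall l : calL, M l -> Omega -> F.
Context {N : nat}.
Variable l : 'I_N -> calL.

Lemma VbarP (f : ('I_N -> Omega) -> F) :
  Vbar phi l f <-> exists x : multi_class M l -> K, f = \sum_a x a *: phibar_class phi a.
Proof.
have part (y : multi_index M l -> K) : \sum_m y m *: phibar phi m =
    \sum_a (\sum_(m | \pi_(multi_class M l)%qT m == a) y m) *: phibar_class phi a.
  rewrite (partition_big (fun m : multi_index M l => \pi_(multi_class M l)%qT m) xpredT)//=.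
  apply: eq_bigr => a _; rewrite scaler_suml; apply: eq_bigr => m /eqP <-.
  by rewrite phibar_pi.
split=> [[y ->]|[x ->]].
  by exists (fun a => \sum_(m | \pi_(multi_class M l)%qT m == a) y m).
exists (fun m => if m == repr (\pi_(multi_class M l)%qT m) then
  x (\pi_(multi_class M l)%qT m) else 0).
rewrite part; apply: eq_bigr => a _; congr (_ *: _).
rewrite (bigD1 (repr a)) ?reprK//= eqxx big1 ?addr0// => m /andP[/eqP -> /negPf ->].
by [].
Qed.

Lemma equivariant_of_coef_sum (L : calL) (J : finType) (x : J -> K)
    (c : J -> 'cV[K]_#|{: multi_class M l * M L}|) :
  equivariant_of_coef phi (\sum_i x i *: c i) =
  \sum_i x i *: equivariant_of_coef phi (c i).
Proof.
apply/funext => kk; apply/funext => r.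
rewrite equivariant_of_coefE !fct_sumE.
transitivity (\sum_i x i *: equivariant_of_coef phi (c i) kk r); last by [].
under [RHS]eq_bigr do rewrite equivariant_of_coefE scaler_sumr.
rewrite exchange_big/=; apply: eq_bigr => a _.
rewrite summxE scaler_suml; apply: eq_bigr => i _.
by rewrite mxE scalerA.
Qed.

End CoefficientFunctions.

Theorem theorem2p11
  (R : realType)
  (* the base field K = base_field R k, and the field K0 = base_field R k0 of the
     entries of the linear group G *)
  (k k0 : scalar_kind)
  (n : nat) (G : set 'M[base_field R k0]_n)
  (hG : linear_Lie_group G) (hGconn : connected G)
  (Ndim : nat) (X : 'I_Ndim -> 'M[base_field R k0]_n) (hX : Lie_generators G X)
  (Omega : Type) (act : 'M[base_field R k0]_n -> Omega -> Omega)
  (hact : group_action G act)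
  (F : comAlgType (base_field R k))
  (dL dM : Order.disp_t) (calL : orderType dL)
  (hL : countable [set: calL])
  (M : calL -> finOrderType dM)
  (phi : forall l : calL, M l -> Omega -> F)
  (H : set (Omega -> F)) (ip : (Omega -> F) -> (Omega -> F) -> base_field R k)
  (hip : scalar_product H ip)
  (hphiH : forall (l : calL) (m : M l), H (phi l m))
  (hphi : orthonormal_family phi ip)
  (rho : forall l : calL, 'M[base_field R k0]_n -> M l -> M l -> base_field R k)
  (hrho : forall l : calL, matrix_representation G (rho l))
  (hstable : stable_with_representation G act phi rho)
  (N : nat) (hN : (0 < N)%N)
  (HN : set (('I_N -> Omega) -> F))
  (ipN : (('I_N -> Omega) -> F) -> (('I_N -> Omega) -> F) -> base_field R k)
  (hipN : tensor_scalar_product H ip HN ipN)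
  (l : 'I_N -> calL)
  (hl : forall i j : 'I_N, (i <= j)%N -> (l i <= l j)%O)
  (L : calL)
  (c : (\dim (kerM X rho l L)).-tuple 'cV[base_field R k]_#|{: multi_class M l * M L}|)
  (hc : basis_of (kerM X rho l L) c) :
  is_basis (Vbar_equivariant G act phi rho l L)
    (fun i : 'I_(\dim (kerM X rho l L)) => equivariant_of_coef phi (tnth c i))
  /\ has_dim (Vbar_equivariant G act phi rho l L) (\dim (kerM X rho l L)).
Proof.
have free := phibar_class_free (l := l) hphiH hphi hipN.
have kerE := kerM_equivariant hG hGconn hX hact hrho hstable (l := l) (L := L) free.
suff B : is_basis (Vbar_equivariant G act phi rho l L)
    (fun i : 'I_(\dim (kerM X rho l L)) => equivariant_of_coef phi (tnth c i)).
  by split=> //; exists (fun i => equivariant_of_coef phi (tnth c i)).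
split.
- move=> i; split.
    move=> kk; apply/VbarP; exists (fun a => tnth c i (enum_rank (a, kk)) 0).
    by [].
  move=> g Gg r kk; apply: (kerE _).1 => //.
  by apply: (basis_mem hc); exact: mem_tnth.
- move=> x x0; have c0 : \sum_i x i *: tnth c i = 0.
    apply: (equivariant_of_coef_inj free) => kk r.
    rewrite equivariant_of_coef_sum x0 equivariant_of_coefE big1// => a _.
    by rewrite mxE scale0r.
  have /freeP H0 := basis_free hc; apply: H0.
  by rewrite -[RHS]c0; apply: eq_bigr => i _; rewrite -tnth_nth.
- move=> f [fV fG].
  have /choice[y yP] kk : exists x : multi_class M l -> base_field R k,
      f kk = \sum_a x a *: phibar_class phi a by apply/VbarP; exact: fV.
  pose c1 : 'cV[base_field R k]_#|{: multi_class M l * M L}| :=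
    \col_i y (enum_val i).2 (enum_val i).1.
  have fE : f = equivariant_of_coef phi c1.
    apply/funext => kk; rewrite yP; apply: eq_bigr => a _.
    by rewrite /c1 mxE enum_rankK.
  have c1ker : c1 \in kerM X rho l L.
    by apply/kerE => g Gg r kk; rewrite -fE; exact: fG.
  exists (fun i => coord c i c1).
  rewrite fE -equivariant_of_coef_sum; congr equivariant_of_coef.
  rewrite {1}(coord_basis hc c1ker); apply: eq_bigr => i _.
  by rewrite -tnth_nth.
Qed.
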